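(* Let $k\geq 2$ be an integer, and let $G$ be a countable torsion-free $CSA$-group in which maximal abelian subgroups are cyclic. Let $a_{0}$ be any generator of a maximal abelian subgroup of $G$. Then $G$ embeds into a torsion-free $CSA$-group $H$ in which maximal abelian subgroups are cyclic, such that (identifying $G$ with its image in $H$): $H=\langle F,r\rangle$ is generated by a subgroup $F$ which is a free group over countably infinitely many generators together with an element $r$ satisfying $r^{k}=a_{0}$, and any two maximal abelian subgroups of $G$ are conjugate in $H$. In particular, any element of $G$ has a $k$-th root in $H$.
   Context: A $CSA$-group is a group $\Gamma$ in which every maximal abelian subgroup $A$ is malnormal, i.e. for every $g\in\Gamma$, $A\cap A^{g}\neq 1$ implies $g\in A$, where $A^{g}=g^{-1}Ag$. *)

(* Defs.v *)
(* Groups are the (possibly infinite) [groupType]s of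
   mathcomp.boot.monoid, subsets are those of mathcomp.classical. *)
From mathcomp Require Import all_boot.
From mathcomp Require Import boolp classical_sets functions cardinality.

Set Implicit Arguments.
Unset Strict Implicit.
Unset Printing Implicit Defensive.

Local Open Scope classical_set_scope.
Local Open Scope group_scope.

Section Subgroups.
Variable G : groupType.
Implicit Types (A B S : set G) (g : G).

Definition is_subgroup S : Prop :=
  [/\ S 1,
      (forall x y, S x -> S y -> S (x * y)) &
      (forall x, S x -> S x^-1)].

Definition generated_by S : set G := smallest is_subgroup S.

Definition is_cyclic A : Prop := exists a : G, A = generated_by [set a].

Definition is_abelian S : Prop := forall x y, S x -> S y -> commute x y.

Definition maximal_abelian A : Prop :=
  [/\ is_subgroup A, is_abelian A &
      forall B, is_subgroup B -> is_abelian B -> A `<=` B -> B = A].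

(* A^g = g^-1 A g, since MathComp's [x ^ g] is [g^-1 * (x * g)]. *)
Definition conj_set A g : set G := [set x ^ g | x in A].

Definition malnormal A : Prop :=
  forall g, A `&` conj_set A g <> [set 1] -> A g.

End Subgroups.

Definition is_CSA (G : groupType) : Prop :=
  forall A : set G, maximal_abelian A -> malnormal A.

Definition max_abelian_cyclic (G : groupType) : Prop :=
  forall A : set G, maximal_abelian A -> is_cyclic A.

Definition torsion_free (G : groupType) : Prop :=
  forall (x : G) (n : nat), (0 < n)%N -> x ^+ n = 1 -> x = 1.

Definition conjugate_subgroups (G : groupType) (A B : set G) : Prop :=
  exists g : G, conj_set A g = B.

(* [L] is free with basis [x]: the universal property.  Applied to a [K] with
   two distinct elements, it forces [x] to be injective. *)
Definition free_with_basis (I : Type) (L : groupType) (x : I -> L) : Prop :=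
  forall (K : groupType) (f : I -> K),
    exists2 phi : {multiplicative L -> K}, (forall i, phi (x i) = f i) &
      forall psi : {multiplicative L -> K},
        (forall i, psi (x i) = f i) -> psi =1 phi.

(* [F] is a subgroup of [H], and it is free on countably infinitely many
   generators: [F] is the isomorphic image of such a free group. *)
Definition free_subgroup_countable_rank (H : groupType) (F : set H) : Prop :=
  exists (L : groupType) (x : nat -> L) (j : {multiplicative L -> H}),
    [/\ free_with_basis x, injective j & range j = F].

(* Main.v *)
(* The group [H] is the fundamental group of a star of groups.  Choose one
   generator [a n] in each conjugacy class of maximal abelian subgroups of [G],
   with [a 0 = a0] (indices that are left over get [a n = 1]), and let [H] be
   generated by [G], an element [r] and letters [t n] subject to [t 0 = 1],
   [r ^+ k = a 0] and [r ^+ k * t n = t n * a n] whenever [a n <> 1].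

   [H] acts on its Bass-Serre tree, whose vertex stabilizers are the conjugates
   of [G] and of [<r>].  The [a n] generate malnormal, pairwise non-conjugate
   subgroups whose conjugates cover [G], so an element fixing a vertex fixes a
   vertex of type [<r>], and fixes only one such vertex unless it is [1].  Hence
   the commensurator of [<h>], [h <> 1], is infinite cyclic: it is contained in
   the stabilizer of that vertex or acts by translations on the axis of [h].
   This gives the CSA property, torsion-freeness and cyclicity at once.

   The tree is obtained without normal forms for amalgams.  A group [M] of
   permutations already contains [G], [r] and the [t n] with the relations above
   (free actions of infinite cyclic groups with countably many orbits are
   isomorphic), and [M] acts on the bipartite graph of its cosets of [G] and
   [<r>].  The tree is the universal cover of that graph, and [H] consists of
   lifts: it lives in the semidirect product by [M] of the free group on the
   edges.

   [F] is generated by the [t n.+1] and by the [r * t n.+1 * g n * r^-1], where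
   [g n] enumerates [G]; it is free because its image in a group in which [G]
   and [r ^+ k] die is free.  If [G] is trivial then [r = 1] is forced, and [H]
   is a free group, which embeds in the group built from the integers. *)
From HB Require Import structures.
Require Import Defs.
From mathcomp Require Import all_boot.
From mathcomp Require Import ssralg ssrnum ssrint intdiv zify.
From mathcomp Require Import boolp classical_sets functions cardinality.

Set Implicit Arguments.
Unset Strict Implicit.
Unset Printing Implicit Defensive.

Local Open Scope classical_set_scope.
Local Open Scope group_scope.

Definition mult_pack (G H : groupType) (f : G -> H)
    (fM : {morph f : x y / x * y}) : {multiplicative G -> H} :=
  HB.pack f (isMultiplicative.Build G H f fM).

(** * Integer powers *)

Definition zpow (G : groupType) (x : G) (z : int) : G :=
  match z with Posz n => x ^+ n | Negz n => x ^- n.+1 end.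

Section ZPow.
Variable G : groupType.
Implicit Types (x y g : G) (z w : int).

Lemma zpow0 x : zpow x 0 = 1. Proof. by []. Qed.
Lemma zpow1 x : zpow x 1 = x. Proof. by []. Qed.

Lemma zpowS x z : zpow x (z + 1)%R = zpow x z * x.
Proof.
case: z => [n|[|n]].
- have -> : (Posz n + 1)%R = Posz n.+1 by lia.
  by rewrite /= expgSr.
- by rewrite /= expg1 mulVg.
- have -> : (Negz n.+1 + 1)%R = Negz n by lia.
  by rewrite /= [x ^+ n.+2]expgS invgM mulgVK.
Qed.

Lemma zpowD x z w : zpow x (z + w)%R = zpow x z * zpow x w.
Proof.
elim/int_rec: w => [|n IHn|n IHn]; first by rewrite GRing.addr0 zpow0 mulg1.
  have -> : (z + Posz n.+1)%R = (z + Posz n + 1)%R by lia.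
  rewrite zpowS IHn.
  have -> : (Posz n.+1)%R = (Posz n + 1)%R by lia.
  by rewrite zpowS mulgA.
apply: (mulIg x); rewrite -zpowS.
have -> : (z - (Posz n.+1) + 1)%R = (z - Posz n)%R by lia.
rewrite IHn -mulgA -zpowS; congr (_ * zpow x _); lia.
Qed.

Lemma zpowN x z : zpow x (- z)%R = (zpow x z)^-1.
Proof.
by apply/esym/mulg1_eq; rewrite -zpowD; have -> : (z - z)%R = 0%R by lia.
Qed.

Lemma zpowC x z w : zpow x z * zpow x w = zpow x w * zpow x z.
Proof. by rewrite -!zpowD GRing.addrC. Qed.

Lemma zpowM x z w : zpow (zpow x z) w = zpow x (z * w)%R.
Proof.
elim/int_rec: w => [|n IHn|n IHn].
- by rewrite GRing.mulr0.
- have -> : (Posz n.+1)%R = (Posz n + 1)%R by lia.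
  by rewrite zpowS IHn -zpowD; congr zpow; lia.
- apply: (mulIg (zpow x z)); rewrite -zpowS -zpowD.
  have -> : (- (Posz n.+1) + 1)%R = (- Posz n)%R by lia.
  rewrite IHn; congr zpow; lia.
Qed.

Lemma zpow_nat x n : zpow x (Posz n) = x ^+ n. Proof. by []. Qed.

Lemma zpowJ x g z : (zpow x z) ^ g = zpow (x ^ g) z.
Proof. by case: z => n /=; rewrite ?conjVg conjXg. Qed.

Lemma zpow1n z : zpow (1 : G) z = 1.
Proof. by case: z => n /=; rewrite expg1n ?invg1. Qed.

Lemma generated_by1P x y : generated_by [set x] y <-> exists z, y = zpow x z.
Proof.
split.
  move=> /(_ [set y | exists z, y = zpow x z]); apply; split.
    split.
    - by exists 0%R.
    - by move=> _ _ [z ->] [w ->]; exists (z + w)%R; rewrite zpowD.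
    - by move=> _ [z ->]; exists (- z)%R; rewrite zpowN.
  by move=> _ ->; exists 1%R.
case=> z -> S [[S1 SM SV] /(_ x erefl) Sx].
have SX n : S (x ^+ n) by elim: n => [|n IHn] //; rewrite expgS; apply: SM.
by case: z => n /=; [|apply: SV]; apply: SX.
Qed.

End ZPow.

Section Morph.
Variables (G H : groupType) (f : G -> H).
Hypothesis fM : {morph f : x y / x * y}.

Lemma morph_1 : f 1 = 1.
Proof. by apply: (mulgI (f 1)); rewrite -fM !mulg1. Qed.

Lemma morph_V : {morph f : x / x^-1}.
Proof. by move=> x; apply/esym/mulg1_eq; rewrite -fM mulgV morph_1. Qed.

Lemma morph_X n : {morph f : x / x ^+ n}.
Proof.
by move=> x; elim: n => [|n IHn]; rewrite ?morph_1 // !expgS fM IHn.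
Qed.

Lemma morph_zpow x z : f (zpow x z) = zpow (f x) z.
Proof. by case: z => n; rewrite /zpow ?morph_V morph_X. Qed.

Lemma morph_J : {morph f : x y / x ^ y}.
Proof. by move=> x y; rewrite /conjg !fM morph_V. Qed.

Lemma morph_inj : (forall x, f x = 1 -> x = 1) -> injective f.
Proof. by move=> fI x y xy; apply/divg1_eq/fI; rewrite fM morph_V xy mulgV. Qed.

End Morph.

Section Subgroups.
Variable G : groupType.
Implicit Types (S : set G) (x : G).

Lemma is_subgroupX S x n : is_subgroup S -> S x -> S (x ^+ n).
Proof.
by case=> S1 SM _ Sx; elim: n => [|n IHn] //; rewrite expgS; apply: SM.
Qed.

Lemma is_subgroup_zpow S x z : is_subgroup S -> S x -> S (zpow x z).
Proof.
move=> sS Sx; case: z => n /=; first exact: is_subgroupX.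
by case: (sS) => _ _; apply; apply: is_subgroupX.
Qed.

Lemma generated_by_subgroup S : is_subgroup (generated_by S).
Proof.
split=> [A [[]]//|x y Sx Sy A AP|x Sx A AP].
  by case: (AP) => -[_ AM _] _; apply: AM; [apply: Sx|apply: Sy].
by case: (AP) => -[_ _ AV] _; apply: AV; apply: Sx.
Qed.

Lemma generated_by_zpow_abelian x : is_abelian (generated_by [set x]).
Proof. by move=> _ _ /generated_by1P[z ->] /generated_by1P[w ->]; apply: zpowC. Qed.

End Subgroups.

(** * Groups in which commensurators of cyclic subgroups are cyclic *)

(* [S] contains the commensurator of [<h>] and embeds into the integers. *)
Definition axial_at (H : groupType) (h : H) : Prop :=
  exists (S : set H) (phi : H -> int),
    [/\ is_subgroup S,
        (forall x y, S x -> S y -> phi (x * y) = (phi x + phi y)%R),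
        (forall x, S x -> phi x = 0%R -> x = 1) &
        forall g m n, (0 < m)%N -> (0 < n)%N ->
          (h ^+ m) ^ g = h ^+ n \/ (h ^+ m) ^ g = h ^- n -> S g].

Definition axial (H : groupType) : Prop := forall h : H, h <> 1 -> axial_at h.

Section IntegerEmbedding.
Variables (H : groupType) (S : set H) (phi : H -> int).
Hypothesis sS : is_subgroup S.
Hypothesis phiD :
  forall x y, S x -> S y -> phi (x * y) = (phi x + phi y)%R.
Hypothesis phi_inj : forall x, S x -> phi x = 0%R -> x = 1.

Lemma embed1 : phi 1 = 0%R.
Proof. by case: sS => S1 _ _; have := phiD S1 S1; rewrite mulg1; lia. Qed.

Lemma embedV x : S x -> phi x^-1 = (- phi x)%R.
Proof.
by case: sS => _ _ SV Sx; have := phiD Sx (SV _ Sx); rewrite mulgV embed1; lia.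
Qed.

Lemma embed_zpow x z : S x -> phi (zpow x z) = (phi x * z)%R.
Proof.
move=> Sx; have phiX n : phi (x ^+ n) = (phi x * Posz n)%R.
  elim: n => [|n IHn]; first by rewrite embed1; lia.
  by rewrite expgS phiD ?IHn //; [lia|apply: is_subgroupX].
case: z => n /=; first exact: phiX.
by rewrite embedV ?phiX; [lia|apply: is_subgroupX].
Qed.

Lemma embed_eq x y : S x -> S y -> phi x = phi y -> x = y.
Proof.
case: sS => _ SM SV Sx Sy exy; apply: divg1_eq; apply: phi_inj.
  by apply: SM => //; apply: SV.
by rewrite phiD ?embedV //; [lia|apply: SV].
Qed.

Lemma embed_abelian : is_abelian S.
Proof.
case: (sS) => _ SM SV x y Sx Sy; apply: embed_eq; try exact: SM.
by rewrite !phiD // GRing.addrC.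
Qed.

(** As for subgroups of the integers: an element [c] of [A] with the least positive value of [phi]
    generates [A], by division with remainder. *)
Lemma embed_cyclic (A : set H) :
  is_subgroup A -> A `<=` S -> is_cyclic A.
Proof.
move=> sA AS; have [A1 AM AV] := sA.
have [[x Ax x_neq0]|A0] := pselect (exists2 x, A x & phi x <> 0%R); last first.
  exists 1; apply/seteqP; split=> y.
    move=> Ay; apply/generated_by1P; exists 0%R.
    by apply: phi_inj; [apply: AS|apply: contrapT => y0; apply: A0; exists y].
  by move/generated_by1P => [z ->]; rewrite zpow1n.
(* The shift to [n.+1] restricts the search for a minimum to positive values. *)
pose P n := `[< exists2 y, A y & phi y = Posz n.+1 >].
have exP : exists n, P n.
  exists (absz (phi x)).-1; apply/asboolP.
  have [x_gt0|x_lt0] : (phi x > 0)%R \/ (phi x < 0)%R by lia.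
    by exists x => //; lia.
  by exists x^-1; [exact: AV|rewrite embedV; [lia|exact: AS]].
case: (ex_minnP exP) => d /asboolP[c Ac phic] cmin.
exists c; apply/seteqP; split=> y; last first.
  by move/generated_by1P => [z ->]; apply: is_subgroup_zpow.
move=> Ay; apply/generated_by1P; exists (divz (phi y) d.+1).
apply: embed_eq; [exact: AS|by apply: AS; apply: is_subgroup_zpow|].
rewrite embed_zpow; last exact: AS.
set q := divz _ _.
have Ac' : A (zpow c (- q)%R) by apply: is_subgroup_zpow.
have phiyc : phi (y * zpow c (- q)%R) = modz (phi y) d.+1.
  by rewrite phiD ?(embed_zpow _ (AS _ Ac)) ?phic; [lia|exact: AS|exact: AS].
case E: (modz (phi y) d.+1) => [[|n]|n]; [rewrite phic; lia| |lia].
have /cmin : P n.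
  by apply/asboolP; exists (y * zpow c (- q)%R); [exact: AM|rewrite phiyc E].
lia.
Qed.

End IntegerEmbedding.

Section Axial.
Variable H : groupType.
Hypothesis axH : axial H.

Lemma axial_torsion_free : torsion_free H.
Proof.
move=> x n n_gt0 xn1; apply: contrapT => x_neq1.
have [S [phi [sS phiD phi_inj Sc]]] := axH x_neq1.
have Sx : S x by apply: (Sc x 1%N 1%N) => //; left; rewrite conjgE mulKg.
have : phi (zpow x n) = 0%R by rewrite zpow_nat xn1 (embed1 sS phiD).
rewrite (embed_zpow sS phiD) // => phi0.
by apply: x_neq1; apply: phi_inj => //; lia.
Qed.

(** The elements of [A] centralize [h], hence lie in [S], which is abelian because it embeds into
    the integers. Maximality then forces [S = A]. *)
Lemma axial_max_abelian (A : set H) h : maximal_abelian A -> A h -> h <> 1 ->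
  exists phi : H -> int,
    [/\ (forall x y, A x -> A y -> phi (x * y) = (phi x + phi y)%R),
        (forall x, A x -> phi x = 0%R -> x = 1) &
        forall g m n, (0 < m)%N -> (0 < n)%N ->
          (h ^+ m) ^ g = h ^+ n \/ (h ^+ m) ^ g = h ^- n -> A g].
Proof.
move=> [sA abA maxA] Ah /axH[S [phi [sS phiD phi_inj Sc]]].
suff <- : S = A by exists phi.
apply: maxA => //; first exact: (embed_abelian sS phiD).
move=> x Ax; apply: (Sc x 1%N 1%N) => //; left.
by rewrite !expg1 conjgE (abA h x) // mulKg.
Qed.

Lemma axial_max_abelian_cyclic : max_abelian_cyclic H.
Proof.
move=> A maxA; have [sA _ _] := maxA.
have [[h Ah h_neq1]|A1] := pselect (exists2 h, A h & h <> 1).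
  have [phi [phiD phi_inj _]] := axial_max_abelian maxA Ah h_neq1.
  by apply: (embed_cyclic sA phiD).
exists 1; apply/seteqP; split=> y; last first.
  by case/generated_by1P => z ->; rewrite zpow1n; case: sA.
move=> Ay; apply/generated_by1P; exists 0%R.
by apply: contrapT => y_neq1; apply: A1; exists y.
Qed.

(** If [x] and [y = x ^ g] are nontrivial in [A], the embedding of [A] into the integers makes the
    powers of [y] and [x] with exponents [absz (phi x)] and [absz (phi y)] equal up to inversion. So
    [g] commensurates [<x>] and lies in [A]. *)
Lemma axial_CSA : is_CSA H.
Proof.
move=> A maxA g; have [sA _ _] := maxA => AAg.
have [x [Ax Axg x_neq1]] : exists x, [/\ A x, A (x ^ g) & x <> 1].
  apply: contrapT => noA; apply: AAg; apply/seteqP; split=> [y [Ay [x Ax xy]]|_ ->].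
    apply: contrapT => y_neq1; apply: noA; exists x; rewrite xy; split=> //.
    by move=> x1; apply: y_neq1; rewrite -xy x1 conj1g.
  by have [A1 _ _] := sA; split=> //; exists 1; rewrite ?conj1g.
have [phi [phiD phi_inj]] := axial_max_abelian maxA Ax x_neq1.
have phi_neq0 y : A y -> y <> 1 -> phi y <> 0%R.
  by move=> Ay y_neq1 /phi_inj - /(_ Ay).
have y_neq1 : x ^ g <> 1 by move/eqP; rewrite conjg_eq1 => /eqP.
have := phi_neq0 _ Ax x_neq1; have := phi_neq0 _ Axg y_neq1.
have := conjXg x g; move: (x ^ g) Axg => y Ay xyg p_neq0 q_neq0 Sc.
have p_gt0 : (0 < absz (phi y))%N by lia.
have q_gt0 : (0 < absz (phi x))%N by lia.
apply: (Sc g _ _ q_gt0 p_gt0) => /=; rewrite xyg.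
have eqX (n : nat) (z : int) : (phi y * n = phi x * z)%R -> y ^+ n = zpow x z.
  move=> e; rewrite -zpow_nat; apply: (embed_eq sA phiD phi_inj).
  - exact: is_subgroup_zpow.
  - exact: is_subgroup_zpow.
  - by rewrite !(embed_zpow sA phiD).
have [e|e] : (phi y * absz (phi x) = phi x * absz (phi y))%R \/
    (phi y * absz (phi x) = phi x * - (Posz (absz (phi y))))%R.
- by nia.
- by left; rewrite (eqX _ _ e).
- by right; rewrite (eqX _ _ e) zpowN.
Qed.

End Axial.

Lemma axial_inj (H K : groupType) (f : K -> H) :
  {morph f : x y / x * y} -> injective f -> axial H -> axial K.
Proof.
move=> fM f_inj axH h h_neq1.
have f1 := morph_1 fM; have fV := morph_V fM; have fX := morph_X fM.
have fh_neq1 : f h <> 1 by rewrite -f1 => /f_inj.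
have [S [phi [[S1 SM SV] phiD phi_inj Sc]]] := axH _ fh_neq1.
exists (f @^-1` S), (phi \o f); split=> /=.
- split=> [|x y|x] /=; first by rewrite f1.
  + by rewrite fM; apply: SM.
  + by rewrite fV; apply: SV.
- by move=> x y Sx Sy; rewrite fM phiD.
- by move=> x Sx /phi_inj - /(_ Sx); rewrite -f1 => /f_inj.
- move=> g m n m_gt0 n_gt0 hg; apply: (Sc _ m n) => //.
  by rewrite -!fX -fV -(morph_J fM); case: hg => ->; [left|right].
Qed.

(** * Groups acting on bipartite forests *)

Section Paths.
Variables (X : Type) (adj : X -> X -> Prop).
Implicit Types (p q : nat -> X) (n m : nat) (x y z : X).

(** Only the values of [p] at indices up to [n] count. With total functions, walks are cut, reversed
    and taken out of lines by index arithmetic. *)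
Definition walk p n : Prop := forall i, (i < n)%N -> adj (p i) (p i.+1).

Definition reduced p n : Prop :=
  walk p n /\ forall i, (i.+2 <= n)%N -> p i <> p i.+2.

Definition connected n x y : Prop :=
  exists p, [/\ walk p n, p 0%N = x & p n = y].

(** This describes a forest: connectedness is not part of it. *)
Definition acyclic : Prop :=
  forall p n, reduced p n -> (0 < n)%N -> p 0%N <> p n.

Definition path_cat p n q : nat -> X :=
  fun i => if (i <= n)%N then p i else q (i - n)%N.

Lemma path_catl p n q i : (i <= n)%N -> path_cat p n q i = p i.
Proof. by rewrite /path_cat => ->. Qed.

Lemma path_catr p n q i : p n = q 0%N -> path_cat p n q (n + i) = q i.
Proof.
rewrite /path_cat => pq; case: ifPn => [ni|_]; last by congr q; lia.
have -> : i = 0%N by lia.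
by rewrite addn0.
Qed.

Lemma walk_cat p n q m : walk p n -> walk q m -> p n = q 0%N ->
  walk (path_cat p n q) (n + m).
Proof.
move=> wp wq pq i i_lt; have [i_lt_n|n_le_i] := ltnP i n.
  by rewrite !path_catl ?(ltnW i_lt_n) //; apply: wp.
have [k ik] : exists k, i = (n + k)%N by exists (i - n)%N; lia.
by rewrite ik -addnS !path_catr //; apply: wq; lia.
Qed.

Lemma reduced_cat p n q m : reduced p n -> reduced q m -> p n = q 0%N ->
    ((0 < n)%N -> (0 < m)%N -> p n.-1 <> q 1%N) ->
  reduced (path_cat p n q) (n + m).
Proof.
move=> [wp rp] [wq rq] pq pq1; split; first exact: walk_cat.
move=> i i_lt; have [i_lt_n|n_le_i] := ltnP i.+1 n.
  by rewrite !path_catl; [apply: rp|lia..].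
have [n_eq|n_neq] := pselect (n = i.+1).
  rewrite path_catl; last by lia.
  have -> : i.+2 = (n + 1)%N by lia.
  by rewrite path_catr //; have := pq1; rewrite n_eq; apply; lia.
have [k ik] : exists k, i = (n + k)%N by exists (i - n)%N; lia.
by rewrite ik -!addnS !path_catr //; apply: rq; lia.
Qed.

Hypothesis adj_sym : forall x y, adj x y -> adj y x.

Lemma reduced_rev p n : reduced p n -> reduced (fun i => p (n - i)%N) n.
Proof.
move=> [wp rp]; split=> i i_lt.
  have -> : (n - i = (n - i.+1).+1)%N by lia.
  by apply/adj_sym/wp; lia.
have -> : (n - i = (n - i.+2).+2)%N by lia.
by apply/nesym/rp; lia.
Qed.

Lemma connected_sym n x y : connected n x y -> connected n y x.
Proof.
move=> [p [wp <- <-]]; exists (fun i => p (n - i)%N); split.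
- move=> i i_lt; have -> : (n - i = (n - i.+1).+1)%N by lia.
  by apply/adj_sym/wp; lia.
- by rewrite subn0.
- by rewrite subnn.
Qed.

Lemma connected_trans n m x y z :
  connected n x y -> connected m y z -> connected (n + m) x z.
Proof.
move=> [p [wp px py]] [q [wq qy qz]]; have pq : p n = q 0%N by rewrite py qy.
exists (path_cat p n q); split; first exact: walk_cat.
  by rewrite path_catl.
by rewrite path_catr.
Qed.

Lemma connected_shortcut p n i : walk p n -> (i.+2 <= n)%N -> p i = p i.+2 ->
  connected (n - 2) (p 0%N) (p n).
Proof.
move=> wp i_le pi; have -> : (n - 2 = i + (n - i.+2))%N by lia.
apply: (@connected_trans _ _ _ (p i)).
  by exists p; split=> // j j_lt; apply: wp; lia.
rewrite pi; exists (fun j => p (i.+2 + j)%N); split.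
- by move=> j j_lt; rewrite addnS; apply: wp; lia.
- by rewrite addn0.
- by congr p; lia.
Qed.

(** Each backtrack is cut out, which shortens the walk by two. *)
Lemma connected_reduced n x y : connected n x y ->
  exists p m, [/\ reduced p m, p 0%N = x & p m = y].
Proof.
elim/ltn_ind: n => n IHn [p [wp px py]].
have [rp|nrp] := pselect (forall i, (i.+2 <= n)%N -> p i <> p i.+2).
  by exists p, n.
move: nrp; rewrite -existsNE => -[i] /not_implyP[i_le /contrapT pi].
apply: (IHn (n - 2)%N); first by lia.
by rewrite -px -py; apply: connected_shortcut pi.
Qed.

Hypothesis acyc : acyclic.

Lemma reduced_unique p n q m : reduced p n -> reduced q m ->
    p 0%N = q 0%N -> p n = q m ->
  n = m /\ forall i, (i <= n)%N -> p i = q i.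
Proof.
elim: n m p q => [|n IHn] [|m] p q rp rq pq0 pqn.
- by split=> // -[].
- by have := acyc rq (ltn0Sn m); rewrite -pqn pq0.
- by have := acyc rp (ltn0Sn n); rewrite pqn pq0.
have [pq1|pq1] := pselect (p 1%N = q 1%N).
  have reduced_tl k r : reduced r k.+1 -> reduced (fun i => r i.+1) k.
    by case=> wr rr; split=> i i_lt; [apply: wr|apply: rr].
  have [-> pq] := IHn _ _ _ (reduced_tl _ _ rp) (reduced_tl _ _ rq) pq1 pqn.
  by split=> // -[|i] // i_le; apply: pq.
(* If the first edges differ, the reverse of [p] followed by [q] does not backtrack at the junction:
   it is a closed reduced walk. *)
have rpq : reduced (path_cat (fun i => p (n.+1 - i)%N) n.+1 q) (n.+1 + m.+1).
  apply: reduced_cat => //; first exact: reduced_rev.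
    by rewrite subnn.
  by move=> _ _ /=; rewrite subSnn.
have := acyc rpq (ltn0Sn _).
by rewrite path_catl // path_catr ?subnn // subn0 pqn.
Qed.

Definition line (p : int -> X) : Prop :=
  forall i, adj (p i) (p (i + 1)%R) /\ p i <> p (i + 2)%R.

Lemma line_reduced (p : int -> X) i n :
  line p -> reduced (fun j => p (i + Posz j)%R) n.
Proof.
move=> lp; split=> j _.
  have -> : (i + Posz j.+1 = i + Posz j + 1)%R by lia.
  by have [] := lp (i + Posz j)%R.
have -> : (i + Posz j.+2 = i + Posz j + 2)%R by lia.
by have [] := lp (i + Posz j)%R.
Qed.

Lemma line_opp (p : int -> X) : line p -> line (fun i => p (- i)%R).
Proof.
move=> lp i; split.
  apply: adj_sym; have [+ _] := lp (- (i + 1))%R.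
  by have -> : (- (i + 1) + 1 = - i)%R by lia.
have [_ /nesym] := lp (- (i + 2))%R.
by have -> : (- (i + 2) + 2 = - i)%R by lia.
Qed.

Lemma line_inj (p : int -> X) : line p -> injective p.
Proof.
move=> lp; suff inj_lt i j : (i < j)%R -> p i <> p j.
  move=> i j pij; have [|[|//]] : (i < j)%R \/ (j < i)%R \/ i = j by lia.
    by move=> /inj_lt.
  by move=> /inj_lt; rewrite pij.
move=> ij; have j_gt0 : (0 < absz (j - i))%N by lia.
have := acyc (@line_reduced p i (absz (j - i)) lp) j_gt0.
have -> : (i + Posz 0)%R = i by lia.
by have -> : (i + Posz (absz (j - i)))%R = j by lia.
Qed.

End Paths.

(** * Elliptic and hyperbolic elements of a group acting on a forest *)

Section ForestAction.
Variables (H : groupType) (X : Type) (act : H -> X -> X).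
Variables (adj : X -> X -> Prop) (ty : X -> bool) (x0 : X).
Implicit Types (g h : H) (x y z : X).

Hypothesis act1 : forall x, act 1 x = x.
Hypothesis actM : forall g h x, act (g * h) x = act g (act h x).
Hypothesis adj_sym : forall x y, adj x y -> adj y x.
Hypothesis adj_act : forall h x y, adj x y -> adj (act h x) (act h y).
Hypothesis adj_ty : forall x y, adj x y -> ty y = ~~ ty x.
Hypothesis act_ty : forall h x, ty (act h x) = ty x.
Hypothesis acyc : acyclic adj.

(** The tree of the argument is the component of [x0]. Type [true] is meant for the vertices
    stabilized by conjugates of [<r>], type [false] for those stabilized by conjugates of [G]. *)
Let conn x := exists n, connected adj n x0 x.

Hypothesis conn_act0 : forall h, conn (act h x0).
(** The next three hypotheses abstract, in turn, malnormality and non-conjugacy of the subgroups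
    [<a n>], the covering of [G] by their conjugates, and the infinite order of [r]. *)
Hypothesis fix_edges : forall h x y z, adj x y -> adj y z -> x <> z ->
  ty y = false -> act h x = x -> act h y = y -> act h z = z -> h = 1.
Hypothesis fix_false : forall h x, conn x -> ty x = false -> act h x = x ->
  exists2 y, adj x y & act h y = y.
Hypothesis stab_true : forall x, conn x -> ty x = true ->
  exists phi : H -> int,
    (forall g h, act g x = x -> act h x = x ->
       phi (g * h) = (phi g + phi h)%R) /\
    (forall h, act h x = x -> phi h = 0%R -> h = 1).

Lemma actK h : cancel (act h) (act h^-1).
Proof. by move=> x; rewrite -actM mulVg act1. Qed.

Lemma actKV h : cancel (act h^-1) (act h).
Proof. by move=> x; rewrite -actM mulgV act1. Qed.

Lemma act_inj h : injective (act h).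
Proof. exact: can_inj (actK h). Qed.

Lemma stab_subgroup x : is_subgroup [set g | act g x = x].
Proof.
split=> [|g h /= gx hx|g /= gx]; first exact: act1.
  by rewrite actM hx.
by rewrite -{1}gx actK.
Qed.

Lemma fixX h x n : act h x = x -> act (h ^+ n) x = x.
Proof. exact: (is_subgroupX n (stab_subgroup x)). Qed.

Lemma connected_act n h x y :
  connected adj n x y -> connected adj n (act h x) (act h y).
Proof.
move=> [p [wp <- <-]]; exists (act h \o p); split=> // i i_lt.
by apply: adj_act; apply: wp.
Qed.

Lemma conn_act h x : conn x -> conn (act h x).
Proof.
move=> [n cx]; have [m cm] := conn_act0 h; exists (m + n)%N.
by apply: connected_trans cm _; apply: connected_act.
Qed.

Lemma conn2 x y : conn x -> conn y -> exists n, connected adj n x y.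
Proof.
move=> [n cx] [m cy]; exists (n + m)%N.
by apply: connected_trans cy; apply: connected_sym.
Qed.

Lemma conn_adj x y : conn x -> adj x y -> conn y.
Proof.
move=> [n cx] xy; exists (n + 1)%N; apply: connected_trans cx _.
by exists (fun i => if i is 0%N then x else y); split=> // -[].
Qed.

(** The reduced walk from [x] to [y] is unique, so [h] fixes it pointwise. Its second vertex has
    type [false], and [fix_edges] applies to its first three vertices. *)
Lemma fix_true_unique h x y : conn x -> conn y -> ty x = true -> ty y = true ->
  act h x = x -> act h y = y -> h <> 1 -> x = y.
Proof.
move=> cx cy tx ty' hx hy h_neq1; apply: contrapT => xy.
have [k ck] := conn2 cx cy; have [p [n [rp px py]]] := connected_reduced ck.
have rhp : reduced adj (act h \o p) n.
  case: rp => wp rp; split=> i i_lt; first exact/adj_act/wp.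
  by move/act_inj; apply: rp.
have [_ fixp] : n = n /\ forall i, (i <= n)%N -> (act h \o p) i = p i.
  by apply: (reduced_unique adj_sym acyc rhp rp); rewrite /= ?px ?py.
(* Length 0 gives [x = y], and length 1 contradicts the alternation of types. *)
have [wp np] := rp; case: n {rhp} rp py wp np fixp => [|[|n]] rp py wp np fixp.
- by apply: xy; rewrite -px -py.
- by have /adj_ty := wp 0%N isT; rewrite px py tx ty'.
apply: h_neq1; apply: (@fix_edges h (p 0%N) (p 1%N) (p 2%N)).
- exact: wp.
- exact: wp.
- exact: np.
- by have /adj_ty := wp 0%N isT; rewrite px tx.
- exact: fixp.
- exact: fixp.
- exact: fixp.
Qed.

Lemma fix_true_ex h x : conn x -> act h x = x ->
  exists w, [/\ conn w, ty w = true & act h w = w].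
Proof.
move=> cx hx; case tx: (ty x); first by exists x.
have [w xw hw] := fix_false cx tx hx; exists w; split=> //.
  exact: conn_adj xw.
by rewrite (adj_ty xw) tx.
Qed.

Lemma fix_torsion_free h x n : conn x -> act h x = x ->
  (0 < n)%N -> h ^+ n = 1 -> h = 1.
Proof.
move=> cx hx n_gt0 hn; have [w [cw tw hw]] := fix_true_ex cx hx.
have [phi [phiD phi_inj]] := stab_true cw tw.
have sS := stab_subgroup w; apply: phi_inj => //.
have : phi (zpow h n) = 0%R by rewrite zpow_nat hn (embed1 sS phiD).
rewrite (embed_zpow sS phiD) //; lia.
Qed.

(** [S] is the stabilizer of a vertex [w] of type [true] fixed by [h]. If [g] commensurates [<h>],
    some nontrivial [h ^+ m] fixes both [w] and its translate by [g], so these coincide. *)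
Lemma axial_elliptic h x : conn x -> act h x = x -> h <> 1 -> axial_at h.
Proof.
move=> cx hx h_neq1; have [w [cw tw hw]] := fix_true_ex cx hx.
have [phi [phiD phi_inj]] := stab_true cw tw.
have sS := stab_subgroup w; exists [set g | act g w = w], phi; split=> //.
move=> g m n m_gt0 _ hg /=.
have hmw : act (h ^+ m) w = w by apply: fixX.
have hJw : act ((h ^+ m) ^ g) w = w.
  have [_ _ sV] := sS; case: hg => ->; first exact: fixX.
  by apply: sV; apply: fixX.
apply/esym; apply: (@fix_true_unique (h ^+ m)) => //.
- exact: conn_act.
- by rewrite act_ty.
- by move: hJw; rewrite conjgE !actM => /(canRL (actKV g)).
- by move/(fix_torsion_free cw hw m_gt0).
Qed.

Definition translation_line h (p : int -> X) (a : int) : Prop :=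
  [/\ line adj p, (forall i, act h (p i) = p (i + a)%R) & forall i, conn (p i)].

Lemma line_translateX h p a n :
  translation_line h p a -> translation_line (h ^+ n) p (a * n)%R.
Proof.
case=> lp hp cp; split=> //; elim: n => [|n IHn] i.
  by rewrite act1; congr p; lia.
by rewrite expgS actM IHn hp; congr p; lia.
Qed.

(** A walk [q] from some [x] to its image, of the least length among all vertices of the component,
    is a fundamental domain: its translates by the powers of [h] are glued to a line. *)
Lemma axis_exists h : (forall x, conn x -> act h x <> x) ->
  exists p (n : nat), (0 < n)%N /\ translation_line h p n.
Proof.
move=> no_fix.
pose P n := `[< exists2 x, conn x & connected adj n x (act h x) >].
have exP : exists n, P n.
  have c0 : conn x0 by exists 0%N, (fun=> x0).
  have [n cn] := conn_act0 h.
  by exists n; apply/asboolP; exists x0.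
case: (ex_minnP exP) => n /asboolP[x cx [q [wq qx qhx]]] nmin.
have shorter y m : conn y -> connected adj m y (act h y) -> (n <= m)%N.
  by move=> cy cm; apply: nmin; apply/asboolP; exists y.
have cq i : (i <= n)%N -> conn (q i).
  elim: i => [|i IHi] i_le; first by rewrite qx.
  by apply: (conn_adj (IHi (ltnW i_le))); apply: wq.
case: n {nmin} wq qhx shorter cq => [|[|n]] wq qhx shorter cq.
- by case: (no_fix x cx); rewrite -qhx.
- have /adj_ty := wq 0%N isT; rewrite qhx act_ty qx; by case: (ty x).
set N := n.+2 in wq qhx shorter cq *.
(* Writing [i = d * N + r], the vertex [p i] is the image of [q r] under the power [d] of [h]. *)
pose p (i : int) := act (zpow h (divz i N)) (q (absz (modz i N))).
have pE (d : int) r : (r <= N)%N -> p (d * N + r)%R = act (zpow h d) (q r).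
  rewrite leq_eqVlt => /orP[/eqP->|r_lt]; rewrite /p.
    have -> : (d * N + N = (d + 1) * N)%R by lia.
    by rewrite mulzK // modzMl zpowS actM /= qx -qhx.
  by rewrite divzMDl // modzMDl divz_small ?modz_small //= GRing.addr0.
have divN i : exists (d : int) (r : nat), (r < N)%N /\ i = (d * N + r)%R.
  have r_ge0 : (0 <= modz i N)%R by apply: modz_ge0.
  have r_lt : (modz i N < N)%R by apply: ltz_pmod.
  exists (divz i N), (absz (modz i N)); split; first by lia.
  by rewrite {1}(divz_eq i N); congr (_ + _)%R; lia.
exists p, N; split=> //; split.
- move=> i; have [d [r [r_lt ->]]] := divN i.
  have -> : (d * N + r + 1)%R = (d * N + r.+1)%R by lia.
  split; first by rewrite !pE; [apply/adj_act/wq|lia..].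
  (* A backtrack inside [q] would shorten [q]. A backtrack where two translates meet would make the
     displacement of [q 1] at most [N - 2]. *)
  have [r2_le|r2_gt] := leqP r.+2 N.
    have -> : (d * N + r + 2)%R = (d * N + r.+2)%R by lia.
    rewrite !pE; [|lia..] => /act_inj qr.
    have := shorter _ _ cx; rewrite -qhx -{1}qx => /(_ (N - 2)%N).
    by move=> /(_ (connected_shortcut wq r2_le qr)); lia.
  have -> : (d * N + r + 2)%R = ((d + 1) * N + 1)%R by lia.
  rewrite !pE; [|lia..]; rewrite zpowS actM => /act_inj qr.
  have : (N <= n)%N; last by lia.
  apply: (shorter (q 1%N)); first exact: cq.
  rewrite -qr; exists (fun i => q i.+1); split=> //.
    by move=> j j_lt; apply: wq; lia.
  by congr q; lia.
- move=> i; have [d [r [r_lt ->]]] := divN i.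
  have -> : (d * N + r + N)%R = ((d + 1) * N + r)%R by lia.
  by rewrite !pE 1?GRing.addrC ?zpowD ?actM //; lia.
- by move=> i; apply/conn_act/cq; lia.
Qed.

(** If the lines were disjoint, a shortest bridge [c] between them would give two reduced walks from
    [p i] to the image of [q j]: along [p] and then across the image of [c], or across [c] and then
    along [q]. Once the lines meet, the powers of [f] make them agree. *)
Lemma axis_unique f p q (a b : nat) : (0 < a)%N -> (0 < b)%N ->
  translation_line f p a -> translation_line f q b ->
  exists t : int, forall i, q i = p (i + t)%R.
Proof.
move=> a_gt0 b_gt0 tp tq; have [lp fp cp] := tp; have [lq fq cq] := tq.
pose P n := `[< exists i j, connected adj n (p i) (q j) >].
have exP : exists n, P n.
  have [n cn] := conn2 (cp 0%R) (cq 0%R).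
  by exists n; apply/asboolP; exists 0%R, 0%R.
case: (ex_minnP exP) => n /asboolP[i [j [c [wc ci cj]]]] nmin.
have shorter i' j' m : connected adj m (p i') (q j') -> (n <= m)%N.
  by move=> cm; apply: nmin; apply/asboolP; exists i', j'.
have [n0|n_gt0] := posnP n; last first.
  have rc : reduced adj c n.
    split=> // k k_le /(connected_shortcut wc k_le); rewrite ci cj => /shorter.
    lia.
  have rfc : reduced adj (act f \o c) n.
    case: rc => _ rc; split=> k k_lt /=; first exact/adj_act/wc.
    by move/act_inj; apply: rc.
  have sp := line_reduced i a lp; have sq := line_reduced j b lq.
  have r1 : reduced adj
      (path_cat (fun k => p (i + Posz k)%R) a (act f \o c)) (a + n).
    apply: reduced_cat => //=; first by rewrite ci fp.
    move=> _ _ e; have : (n <= n.-1)%N; last by lia.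
    apply: (shorter (i + Posz a.-1)%R (j + Posz b)%R); rewrite e -fq -cj.
    exists (fun k => act f (c k.+1)); split=> //.
      by move=> k k_lt; apply/adj_act/wc; lia.
    by rewrite prednK.
  have r2 : reduced adj
      (path_cat c n (fun k => q (j + Posz k)%R)) (n + b).
    apply: reduced_cat => //=; first by rewrite cj; congr q; lia.
    move=> _ _ e; have : (n <= n.-1)%N; last by lia.
    apply: (shorter i (j + Posz 1)%R); rewrite -e -ci.
    by exists c; split=> // k k_lt; apply: wc; lia.
  (* Comparing the second vertices gives [p (i + 1) = c 1], hence a shorter bridge. *)
  have [||_ /(_ 1%N)] := reduced_unique adj_sym acyc r1 r2.
  - by rewrite !path_catl // ci; congr p; lia.
  - by rewrite !path_catr //= ?cj ?fq ?ci ?fp //; congr q; lia.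
  rewrite !path_catl // => e; have : (n <= n.-1)%N; last by lia.
  apply: (shorter (i + Posz 1)%R j); rewrite e -?cj; last by lia.
  exists (fun k => c k.+1); split=> //.
    by move=> k k_lt; apply: wc; lia.
  by rewrite prednK.
have pq : p i = q j by rewrite -ci -cj n0.
have pqX k : p (i + Posz (a * k)%N)%R = q (j + Posz (b * k))%R.
  have [_ fpX _] := line_translateX k tp; have [_ fqX _] := line_translateX k tq.
  by have := congr1 (act (f ^+ k)) pq; rewrite fpX fqX.
(* The segments of both lines from the common vertex to its image under [f ^+ k] are reduced walks
   with the same ends. *)
have same k : (a * k)%N = (b * k)%N /\
    forall s : nat, (s <= a * k)%N -> p (i + Posz s)%R = q (j + Posz s)%R.
  apply: (reduced_unique adj_sym acyc).
  - exact: line_reduced.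
  - exact: line_reduced.
  - by have := pq; congr (_ = _); [congr p|congr q]; lia.
  - exact: pqX.
have ab : a = b by have [] := same 1%N; rewrite !muln1.
subst b; exists (i - j)%R => s.
pose u := (s - j)%R; pose k := absz u.
have [_ fpX _] := line_translateX k tp; have [_ fqX _] := line_translateX k tq.
(* A large power of [f] moves a vertex of any index into the range where [same] compares the
   lines. *)
apply: (@act_inj (f ^+ k)); rewrite fpX fqX.
have [_ /(_ (absz (u + Posz (a * k)%N)%R))] := same (2 * k)%N.
have u_ge0 : (0 <= u + Posz (a * k)%N)%R by rewrite /k; nia.
have u_le : (absz (u + Posz (a * k)%N)%R <= a * (2 * k))%N by rewrite /k; nia.
move=> /(_ u_le) /esym.
congr (_ = _); [congr q|congr p]; rewrite /u in u_ge0 *; lia.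
Qed.

Lemma line_ty p (i : int) : line adj p -> ty (p i) = ty (p 0%R) (+) odd (absz i).
Proof.
move=> lp; have step j : ty (p (j + 1)%R) = ~~ ty (p j).
  by have [/adj_ty] := lp j.
elim/int_rec: i => [|n IHn|n IHn]; first by rewrite addbF.
  have -> : (Posz n.+1 = Posz n + 1)%R by lia.
  have -> : absz (Posz n + 1)%R = n.+1 by lia.
  by rewrite step IHn /= addbN.
have -> : absz (- (Posz n.+1))%R = n.+1 by lia.
move: IHn; have -> : absz (- (Posz n))%R = n by lia.
have -> : (- Posz n = - (Posz n.+1) + 1)%R by lia.
by rewrite step /= addbN => /(canRL negbK).
Qed.

(** Types alternate, so the vertex at 0 or at 1 has type [false]; [fix_edges] applies to it and its
    two neighbours on the line. *)
Lemma fix_line h p : line adj p -> (forall i, act h (p i) = p i) -> h = 1.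
Proof.
move=> lp hp.
have fixp j : ty (p (j + 1)%R) = false -> h = 1.
  move=> tj; have [pj pj2] := lp j; have [pj1 _] := lp (j + 1)%R.
  apply: (fix_edges pj _ pj2) => //.
  by have -> : (j + 2 = j + 1 + 1)%R by lia.
have [t0|t0] := boolP (ty (p 0%R)); last by apply: (fixp (-1)%R); apply/negbTE.
by apply: (fixp 0%R); rewrite (line_ty _ lp) t0.
Qed.

(** [S] consists of the elements that translate the axis of [h], and [phi] is the translation length
    with sign. An element commensurating [<h>] maps the axis to itself by uniqueness; it remains to
    treat reflections. *)
Lemma axial_hyperbolic h : (forall x, conn x -> act h x <> x) -> axial_at h.
Proof.
move=> /axis_exists[p [l [l_gt0 tp]]]; have [lp hp cp] := tp.
pose S := [set g | exists t : int, forall i, act g (p i) = p (i + t)%R].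
have [phi phiP] : exists phi : H -> int,
    forall g, S g -> forall i, act g (p i) = p (i + phi g)%R.
  have : forall g, exists t : int, S g -> forall i, act g (p i) = p (i + t)%R.
    (* The value 0 outside [S] is a placeholder. *)
    by move=> g; have [[t tP]|nS] := pselect (S g); [exists t|exists 0%R].
  by move=> /choice[phi phiP]; exists phi.
have sS : is_subgroup S.
  split=> [|x y [t tP] [s sP]|x [t tP]].
  - by exists 0%R => i; rewrite act1; congr p; lia.
  - by exists (t + s)%R => i; rewrite actM sP tP; congr p; lia.
  - exists (- t)%R => i; apply: (@act_inj x).
    by rewrite actKV tP; congr p; lia.
exists S, phi; split=> //.
- move=> x y Sx Sy; have [_ SM _] := sS.
  have := phiP _ (SM _ _ Sx Sy) 0%R.
  by rewrite actM !phiP // => /(line_inj acyc lp); lia.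
- move=> x Sx phix; apply: (fix_line lp) => i.
  by rewrite phiP // phix; congr p; lia.
move=> g m n m_gt0 n_gt0 hg.
have hgq i : act (h ^+ m) (act g (p i)) = act g (act ((h ^+ m) ^ g) (p i)).
  by rewrite -!actM conjgE mulVKg.
have [_ hX _] := line_translateX n tp.
have tpm : translation_line (h ^+ m) p (Posz (l * m)).
  by have := line_translateX m tp; congr translation_line; lia.
have lg : line adj (act g \o p).
  move=> i; have [pi pi2] := lp i; split; first exact: adj_act.
  by move/act_inj.
have cg i : conn (act g (p i)) by apply: conn_act.
case: hg => hg.
  have tq : translation_line (h ^+ m) (act g \o p) (l * n)%N.
    by split=> //= i; rewrite hgq hg hX; congr (act g (p _)); lia.
  have [||t tP] := axis_unique _ _ tpm tq; [nia|nia|].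
  by exists t => i; apply: tP.
(* Reversing the image line turns the translation by a negative amount into one by a positive
   amount. *)
have tq : translation_line (h ^+ m) (fun i => act g (p (- i)%R)) (l * n)%N.
  split=> //=; first exact: (line_opp adj_sym lg).
  move=> i; rewrite hgq hg; congr act; apply: (@act_inj (h ^+ n)).
  by rewrite actKV hX; congr p; lia.
have [||t tP] := axis_unique _ _ tpm tq; [nia|nia|].
have gp i : act g (p i) = p (t - i)%R.
  by have := tP (- i)%R; rewrite GRing.opprK => ->; congr p; lia.
(* The reflection [g] squares to the identity on the axis. As [g] preserves types, [t] is even, so
   [g] fixes the vertex at [t / 2]; being elliptic of finite order, it is [1]. *)
have g2 : g ^+ 2 = 1.
  by apply: (fix_line lp) => i; rewrite expg2 actM !gp; congr p; lia.
have [s ts] : exists s, t = (s + s)%R.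
  have : ty (p t) = ty (p 0%R) by rewrite -(act_ty g) gp; congr (ty (p _)); lia.
  rewrite (line_ty t lp); case: (ty _); case odd_t: (odd _) => // _;
    by exists (divz t 2); lia.
suff -> : g = 1 by case: sS.
apply: (fix_torsion_free (cp s) _ _ g2) => //.
by rewrite gp ts; congr p; lia.
Qed.

Theorem forest_action_axial : axial H.
Proof.
move=> h h_neq1.
have [[x [cx hx]]|no_fix] := pselect (exists x, conn x /\ act h x = x).
  exact: axial_elliptic hx h_neq1.
by apply: axial_hyperbolic => x cx hx; apply: no_fix; exists x.
Qed.

End ForestAction.

(** * Free groups, subgroups, permutation groups and semidirect products *)

Section FreeGroup.
Variable E : choiceType.

(** The flag is [true] for a generator and [false] for its formal inverse. *)
Definition flip_letter (a : E * bool) : E * bool := (a.1, ~~ a.2).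

Lemma flip_letterK : involutive flip_letter.
Proof. by move=> [e b]; rewrite /flip_letter /= negbK. Qed.

Definition reduced_word (w : seq (E * bool)) : bool :=
  sorted (fun a b => b != flip_letter a) w.

Record free_group := FreeGroup {
  fword :> seq (E * bool);
  fwordP : reduced_word fword
}.

HB.instance Definition _ := [isSub for fword].
HB.instance Definition _ := [Choice of free_group by <:].

(** Letters act on reduced words by permutations, and a product is computed by letting the letters
    of the left factor act on the right one. *)
Definition push_letter (a : E * bool) (w : seq (E * bool)) :=
  if w is b :: w' then if b == flip_letter a then w' else a :: w else [:: a].

Definition push_word (u v : seq (E * bool)) := foldr push_letter v u.

Lemma reduced_word_tl a w : reduced_word (a :: w) -> reduced_word w.
Proof. exact: path_sorted. Qed.

Lemma push_letter_cons a w : reduced_word (a :: w) -> push_letter a w = a :: w.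
Proof. by case: w => //= b w /andP[/negbTE->]. Qed.

Lemma push_letter_reduced a w : reduced_word w -> reduced_word (push_letter a w).
Proof.
case: w => //= b w; case: eqVneq => [_|ba] bw; first exact: path_sorted bw.
by rewrite /= ba.
Qed.

Lemma push_word_reduced u v : reduced_word v -> reduced_word (push_word u v).
Proof. by move=> rv; elim: u => //= a u; apply: push_letter_reduced. Qed.

Lemma push_letterK a w : reduced_word w ->
  push_letter (flip_letter a) (push_letter a w) = w.
Proof.
case: w => [|b w] rw /=; first by rewrite flip_letterK eqxx.
case: eqVneq => [ba|_] /=; last by rewrite flip_letterK eqxx.
by rewrite -ba push_letter_cons.
Qed.

Lemma push_letterKV a w : reduced_word w ->
  push_letter a (push_letter (flip_letter a) w) = w.
Proof. by rewrite -{1}[a]flip_letterK; apply: push_letterK. Qed.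

(** A cancelled pair of letters acts trivially, so reducing a word does not change its action.
    Associativity follows from this. *)
Lemma push_word_letter a v w : reduced_word w ->
  push_word (push_letter a v) w = push_letter a (push_word v w).
Proof.
case: v => [|b v] rw //=; case: eqVneq => [->|//].
by rewrite push_letterKV //; apply: push_word_reduced.
Qed.

Lemma push_wordA u v w : reduced_word w ->
  push_word (push_word u v) w = push_word u (push_word v w).
Proof. by move=> rw; elim: u => //= a u IHu; rewrite push_word_letter ?IHu. Qed.

Lemma push_words0 u : reduced_word u -> push_word u [::] = u.
Proof.
elim: u => //= a u IHu au.
by rewrite IHu ?push_letter_cons //; apply: reduced_word_tl au.
Qed.

Definition flip_word (u : seq (E * bool)) := rev (map flip_letter u).

Lemma flip_wordK : involutive flip_word.
Proof. by move=> u; rewrite /flip_word map_rev revK mapK //; apply: flip_letterK. Qed.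

Lemma flip_word_reduced u : reduced_word u -> reduced_word (flip_word u).
Proof.
rewrite /flip_word /reduced_word rev_sorted sorted_map.
rewrite (@eq_sorted _ _ (fun a b => b != flip_letter a)) // => a b /=.
by rewrite flip_letterK eq_sym.
Qed.

Lemma push_flip_word u : reduced_word u -> push_word (flip_word u) u = [::].
Proof.
elim: u => //= a u IHu au; have ru := reduced_word_tl au.
rewrite /flip_word /= rev_cons /push_word foldr_rcons.
by rewrite -(push_letter_cons au) push_letterK //; apply: IHu.
Qed.

Lemma free_mul_subproof (x y : free_group) : reduced_word (push_word x y).
Proof. by apply: push_word_reduced; apply: fwordP. Qed.
Lemma free_inv_subproof (x : free_group) : reduced_word (flip_word x).
Proof. by apply: flip_word_reduced; apply: fwordP. Qed.

Definition free_mul x y := FreeGroup (free_mul_subproof x y).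
Definition free_inv x := FreeGroup (free_inv_subproof x).
Definition free_one := @FreeGroup [::] isT.

Fact free_mulA : associative free_mul.
Proof. by move=> x y z; apply/val_inj/esym/push_wordA/fwordP. Qed.
Fact free_mul1g : left_id free_one free_mul.
Proof. by move=> x; apply: val_inj. Qed.
Fact free_mulg1 : right_id free_one free_mul.
Proof. by move=> x; apply/val_inj/push_words0/fwordP. Qed.
Fact free_mulVg : left_inverse free_one free_inv free_mul.
Proof. by move=> x; apply/val_inj/push_flip_word/fwordP. Qed.
Fact free_mulgV : right_inverse free_one free_inv free_mul.
Proof.
move=> x; have -> : x = free_inv (free_inv x) by apply/val_inj/esym/flip_wordK.
rewrite -[X in free_mul _ X]/(free_inv _).
rewrite [X in free_mul _ X](_ : _ = free_inv x); first exact: free_mulVg.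
exact/val_inj/flip_wordK.
Qed.

HB.instance Definition _ := isGroup.Build free_group
  free_mulA free_mul1g free_mulg1 free_mulVg free_mulgV.

Definition free_letter (a : E * bool) : free_group := @FreeGroup [:: a] isT.
Definition free_gen (e : E) : free_group := free_letter (e, true).

Lemma free_letterV a : free_letter (flip_letter a) = (free_letter a)^-1.
Proof. exact: val_inj. Qed.

Lemma free_letterE e b :
  free_letter (e, b) = if b then free_gen e else (free_gen e)^-1.
Proof. by case: b => //; rewrite -free_letterV. Qed.

Definition word_val (w : seq (E * bool)) : free_group :=
  foldr (fun a x => free_letter a * x) 1 w.

Lemma word_valE w : reduced_word w -> fword (word_val w) = w.
Proof.
elim: w => //= a w IHw aw; have /IHw wE := reduced_word_tl aw.
by rewrite -[LHS]/(push_letter a (fword (word_val w))) wE push_letter_cons.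
Qed.

Lemma fwordK (x : free_group) : word_val x = x.
Proof. by apply: val_inj; apply: word_valE; apply: fwordP. Qed.

Lemma word_val_rcons w a : word_val (rcons w a) = word_val w * free_letter a.
Proof. by elim: w => [|b w /= ->]; rewrite /= ?mulg1 ?mul1g ?mulgA. Qed.

Lemma word_val_neq1 w : reduced_word w -> w <> [::] -> word_val w <> 1.
Proof. by move=> rw w0 w1; apply: w0; rewrite -(word_valE rw) w1. Qed.

Section Lift.
Variables (K : groupType) (f : E -> K).

Definition lift_letter (a : E * bool) : K := if a.2 then f a.1 else (f a.1)^-1.

Definition lift_word (w : seq (E * bool)) : K :=
  foldr (fun a k => lift_letter a * k) 1 w.

Definition free_lift (x : free_group) : K := lift_word x.

Lemma lift_letter_flip a : lift_letter (flip_letter a) = (lift_letter a)^-1.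
Proof. by case: a => e [] //=; rewrite /lift_letter /= invgK. Qed.

Lemma lift_push_letter a w :
  lift_word (push_letter a w) = lift_letter a * lift_word w.
Proof.
by case: w => //= b w; case: eqVneq => [->|//]; rewrite lift_letter_flip mulVKg.
Qed.

Fact free_liftM : {morph free_lift : x y / x * y}.
Proof.
move=> x y; rewrite -[LHS]/(lift_word (push_word x y)) /free_lift.
elim: (fword x) => [|a u IHu] /=; first by rewrite mul1g.
by rewrite lift_push_letter IHu mulgA.
Qed.

Lemma free_lift_gen e : free_lift (free_gen e) = f e.
Proof. by rewrite /free_lift /= mulg1. Qed.

Lemma free_lift_unique (psi : free_group -> K) :
  {morph psi : x y / x * y} -> (forall e, psi (free_gen e) = f e) ->
  psi =1 free_lift.
Proof.
move=> psiM psi_gen x; rewrite -(fwordK x).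
have gK := free_lift_gen; have psi1 := morph_1 psiM; have psiV := morph_V psiM.
have fV := morph_V free_liftM; elim: (fword x) => [|[e b] u IHu] /=.
  by rewrite psi1.
rewrite psiM free_liftM IHu; congr (_ * _).
by rewrite free_letterE; case: b; rewrite ?psiV ?fV psi_gen gK.
Qed.

End Lift.

Lemma free_lift_eq (K : groupType) (phi psi : free_group -> K) :
  {morph phi : x y / x * y} -> {morph psi : x y / x * y} ->
  (forall e, phi (free_gen e) = psi (free_gen e)) -> phi =1 psi.
Proof.
move=> phiM psiM e x.
by rewrite (free_lift_unique phiM e) -(free_lift_unique psiM (fun=> erefl)).
Qed.

Lemma free_group_basis : free_with_basis free_gen.
Proof.
move=> K f; exists (mult_pack (free_liftM f)).
  exact: free_lift_gen.
by move=> psi psi_gen; apply: free_lift_unique => //; apply: gmulfM.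
Qed.

End FreeGroup.

Section SubgroupType.
Variables (G : groupType) (S : set G).

Record subgroup_of (sS : is_subgroup S) := SubgroupOf {
  sgval : G;
  sgvalP : S sgval
}.

Variable sS : is_subgroup S.

HB.instance Definition _ := gen_eqMixin (subgroup_of sS).
HB.instance Definition _ := gen_choiceMixin (subgroup_of sS).

Lemma sgval_inj : injective (@sgval sS).
Proof.
by move=> [x Sx] [y Sy] /= xy; subst y; rewrite (Prop_irrelevance Sx Sy).
Qed.

Let S1 : S 1. Proof. by case: sS. Qed.
Let SM x y : S x -> S y -> S (x * y). Proof. by case: sS => _ + _; apply. Qed.
Let SV x : S x -> S x^-1. Proof. by case: sS => _ _; apply. Qed.

Definition sg_one := SubgroupOf sS S1.
Definition sg_mul (x y : subgroup_of sS) :=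
  SubgroupOf sS (SM (sgvalP x) (sgvalP y)).
Definition sg_inv (x : subgroup_of sS) := SubgroupOf sS (SV (sgvalP x)).

Fact sg_mulA : associative sg_mul.
Proof. by move=> x y z; apply: sgval_inj; apply: mulgA. Qed.
Fact sg_mul1g : left_id sg_one sg_mul.
Proof. by move=> x; apply: sgval_inj; apply: mul1g. Qed.
Fact sg_mulg1 : right_id sg_one sg_mul.
Proof. by move=> x; apply: sgval_inj; apply: mulg1. Qed.
Fact sg_mulVg : left_inverse sg_one sg_inv sg_mul.
Proof. by move=> x; apply: sgval_inj; apply: mulVg. Qed.
Fact sg_mulgV : right_inverse sg_one sg_inv sg_mul.
Proof. by move=> x; apply: sgval_inj; apply: mulgV. Qed.

HB.instance Definition _ := isGroup.Build (subgroup_of sS)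
  sg_mulA sg_mul1g sg_mulg1 sg_mulVg sg_mulgV.

Lemma sgvalM : {morph @sgval sS : x y / x * y}. Proof. by []. Qed.

End SubgroupType.

Section Permutations.
Variable X : Type.

Record permutation := Permutation {
  permf :> X -> X;
  permf_inv : X -> X;
  permfK : cancel permf permf_inv;
  permf_invK : cancel permf_inv permf
}.

HB.instance Definition _ := gen_eqMixin permutation.
HB.instance Definition _ := gen_choiceMixin permutation.

Lemma permutation_eq (s t : permutation) : s =1 t -> s = t.
Proof.
case: s t => [f f' fK f'K] [g g' gK g'K] /= /funext fg; subst g.
have f'g' : f' = g' by apply/funext => x; rewrite -{1}[x]g'K fK.
by subst g'; congr Permutation; apply: Prop_irrelevance.
Qed.

Definition perm_one := @Permutation id id (fun=> erefl) (fun=> erefl).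
Definition perm_mul (s t : permutation) :=
  @Permutation (s \o t) (permf_inv t \o permf_inv s)
    (can_comp (@permfK s) (@permfK t)) (can_comp (@permf_invK t) (@permf_invK s)).
Definition perm_inv (s : permutation) := Permutation (@permf_invK s) (@permfK s).

Fact perm_mulA : associative perm_mul.
Proof. by move=> s t u; apply: permutation_eq. Qed.
Fact perm_mul1g : left_id perm_one perm_mul.
Proof. by move=> s; apply: permutation_eq. Qed.
Fact perm_mulg1 : right_id perm_one perm_mul.
Proof. by move=> s; apply: permutation_eq. Qed.
Fact perm_mulVg : left_inverse perm_one perm_inv perm_mul.
Proof. by move=> s; apply: permutation_eq => x /=; apply: permfK. Qed.
Fact perm_mulgV : right_inverse perm_one perm_inv perm_mul.
Proof. by move=> s; apply: permutation_eq => x /=; apply: permf_invK. Qed.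

HB.instance Definition _ := isGroup.Build permutation
  perm_mulA perm_mul1g perm_mulg1 perm_mulVg perm_mulgV.

Lemma permME (s t : permutation) x : (s * t) x = s (t x). Proof. by []. Qed.
Lemma perm1E x : (1 : permutation) x = x. Proof. by []. Qed.

End Permutations.

Record group_action (N M : groupType) := GroupAction {
  gact :> M -> N -> N;
  gact1 : forall x, gact 1 x = x;
  gactM : forall m m' x, gact (m * m') x = gact m (gact m' x);
  gact_morph : forall m, {morph gact m : x y / x * y}
}.

Section Semidirect.
Variables (N M : groupType).

Record semidirect (to : group_action N M) := Semidirect {
  sd_ker : N;
  sd_quo : M
}.

Variable to : group_action N M.

Local Notation T := (semidirect to).

HB.instance Definition _ := gen_eqMixin T.
HB.instance Definition _ := gen_choiceMixin T.

Lemma semidirect_eq (x y : T) :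
  sd_ker x = sd_ker y -> sd_quo x = sd_quo y -> x = y.
Proof. by case: x y => ? ? [? ?] /= -> ->. Qed.

Definition sd_one : T := Semidirect to 1 1.
Definition sd_mul (x y : T) : T :=
  Semidirect to (sd_ker x * to (sd_quo x) (sd_ker y)) (sd_quo x * sd_quo y).
Definition sd_inv (x : T) : T :=
  Semidirect to (to (sd_quo x)^-1 (sd_ker x)^-1) (sd_quo x)^-1.

Fact sd_mulA : associative sd_mul.
Proof.
by move=> x y z; apply: semidirect_eq; rewrite /= ?mulgA // gact_morph gactM mulgA.
Qed.
Fact sd_mul1g : left_id sd_one sd_mul.
Proof. by move=> x; apply: semidirect_eq; rewrite /= ?gact1 mul1g. Qed.
Fact sd_mulg1 : right_id sd_one sd_mul.
Proof.
move=> x; apply: semidirect_eq; rewrite /= ?mulg1 //.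
by rewrite (morph_1 (gact_morph to _)) mulg1.
Qed.
Fact sd_mulVg : left_inverse sd_one sd_inv sd_mul.
Proof.
move=> x; apply: semidirect_eq; rewrite /= ?mulVg //.
by rewrite -gact_morph mulVg (morph_1 (gact_morph to _)).
Qed.
Fact sd_mulgV : right_inverse sd_one sd_inv sd_mul.
Proof.
move=> x; apply: semidirect_eq; rewrite /= ?mulgV //.
by rewrite -gactM mulgV gact1 mulgV.
Qed.

HB.instance Definition _ := isGroup.Build T
  sd_mulA sd_mul1g sd_mulg1 sd_mulVg sd_mulgV.

End Semidirect.

(** * The fundamental group of the star of cyclic groups *)

Section Cosets.
Variable M : groupType.
Implicit Types (S : set M) (m n x : M).

(** Left translation acts on all subsets of [M], so that edges and vertices can carry plain subsets
    as labels; adjacency singles out the actual cosets. *)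
Definition lcoset_of m S : set M := [set x | S (m^-1 * x)].

Lemma lcoset_of1 S : lcoset_of 1 S = S.
Proof. by rewrite /lcoset_of invg1; apply/seteqP; split=> x /=; rewrite mul1g. Qed.

Lemma lcoset_ofM m n S : lcoset_of (m * n) S = lcoset_of m (lcoset_of n S).
Proof. by apply/seteqP; split=> x; rewrite /lcoset_of /= invgM mulgA. Qed.

Lemma lcoset_of_eq m n S : is_subgroup S ->
  lcoset_of m S = lcoset_of n S <-> S (m^-1 * n).
Proof.
case=> S1 SM SV; split=> [e|mn].
  have : lcoset_of n S n by rewrite /lcoset_of /= mulVg.
  by rewrite -e.
apply/seteqP; split=> x /= mx.
  by have := SM _ _ (SV _ mn) mx; rewrite invgM invgK mulgA mulgK.
by have := SM _ _ mn mx; rewrite mulgA mulgK.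
Qed.

Lemma lcoset_of_fix m n S : is_subgroup S ->
  lcoset_of m (lcoset_of n S) = lcoset_of n S -> S (n^-1 * m * n).
Proof.
move=> sS; rewrite -lcoset_ofM => /esym/(lcoset_of_eq _ _ sS).
by rewrite mulgA.
Qed.

Lemma range_zpow_subgroup x : is_subgroup [set y | exists z, y = zpow x z].
Proof.
split=> [|_ _ [z ->] [w ->]|_ [z ->]]; first by exists 0%R.
  by exists (z + w)%R; rewrite zpowD.
by exists (- z)%R; rewrite zpowN.
Qed.

End Cosets.

Section Core.
Variables (G M : groupType) (j : G -> M) (r : M) (k : nat).
Variables (a : nat -> G) (t : nat -> M).

Hypothesis jM : {morph j : x y / x * y}.
Hypothesis j_inj : injective j.
Hypothesis r_free : forall z, zpow r z = 1 -> z = 0%R.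
Hypothesis t0 : t 0%N = 1.
Hypothesis ra0 : r ^+ k = j (a 0%N).
Hypothesis rt : forall n, a n <> 1 -> r ^+ k * t n = t n * j (a n).
Hypothesis cover : forall g, exists n x z, g = (zpow (a n) z) ^ x.
(** For [n = m] this is malnormality of [<a n>]; for distinct indices it excludes that conjugates of
    the two subgroups meet nontrivially. *)
Hypothesis separated : forall n m x p q, zpow (a n) p <> 1 ->
  (zpow (a n) p) ^ x = zpow (a m) q -> n = m /\ exists z, x = zpow (a n) z.

Let jX := morph_zpow jM.
Let Gset : set M := range j.
Let Rset : set M := [set x | exists z, x = zpow r z].
Let Aset n : set M := [set x | exists z, x = zpow (j (a n)) z].

Let sG : is_subgroup Gset.
Proof.
split=> [|_ _ [x _ <-] [y _ <-]|_ [x _ <-]].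
- by exists 1 => //; apply: morph_1 jM.
- by exists (x * y) => //; apply: jM.
- by exists x^-1 => //; apply: morph_V jM _.
Qed.

Let sR : is_subgroup Rset := range_zpow_subgroup r.
Let sA n : is_subgroup (Aset n) := range_zpow_subgroup (j (a n)).

Lemma sub_AG n x : Aset n x -> Gset x.
Proof. by case=> z ->; rewrite -jX; exists (zpow (a n) z). Qed.

(** Conjugation by [t n] takes [a n] to [r ^+ k], unless [a n = 1]. Thus the [<r>]-end of an edge
    depends only on its coset of [Aset n]. *)
Lemma AtR n x : Aset n x -> Rset (t n * x * (t n)^-1).
Proof.
case=> z ->; have [an1|an_neq1] := pselect (a n = 1).
  by exists 0%R; rewrite an1 (morph_1 jM) zpow1n mulg1 mulgV.
exists (Posz k * z)%R; rewrite -zpowM zpow_nat.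
have -> : r ^+ k = j (a n) ^ (t n)^-1 by rewrite conjgE invgK mulgA -rt // mulgK.
by rewrite -zpowJ conjgE invgK mulgA.
Qed.

Local Notation E := (nat * set M)%type.
Local Notation F := (free_group E).

Definition edge_act (m : M) (e : E) : E := (e.1, lcoset_of m e.2).

Definition free_act (m : M) : F -> F :=
  free_lift (fun e => free_gen (edge_act m e)).

Lemma free_act_gen m e : free_act m (free_gen e) = free_gen (edge_act m e).
Proof. exact: free_lift_gen. Qed.

Fact free_actM m : {morph free_act m : x y / x * y}.
Proof. exact: free_liftM. Qed.

Fact free_act_1 x : free_act 1 x = x.
Proof.
apply: (free_lift_eq (free_actM 1) (psi := id)) => // e.
by rewrite free_act_gen /edge_act lcoset_of1 -surjective_pairing.
Qed.

Fact free_act_mul m m' x : free_act (m * m') x = free_act m (free_act m' x).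
Proof.
apply: (free_lift_eq (free_actM _) (psi := free_act m \o free_act m')) => [|e].
  by move=> y z; rewrite /= !free_actM.
by rewrite /= !free_act_gen /edge_act lcoset_ofM.
Qed.

Definition free_action : group_action F M :=
  GroupAction free_act_1 free_act_mul free_actM.

Local Notation L := (semidirect free_action).

(* The vertices of the Bass-Serre forest: an element of the free groupoid on
   the edges of the coset graph of [M], together with its end point. *)
Definition vertex : Type := F * (bool * set M).

(** The component in [M] acts on the coset graph and on edge labels; the component in the free group
    acts by left multiplication, over the identity of the coset graph. *)
Definition vact (h : L) (x : vertex) : vertex :=
  (sd_ker h * free_act (sd_quo h) x.1, (x.2.1, lcoset_of (sd_quo h) x.2.2)).

(** In the coset graph, the edge [m (Aset n)] joins [m G] to [m (t n)^-1 <r>]. Its lifts record the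
    crossing by a right factor, which commutes with the left multiplications in [vact]. *)
Definition arc (e : E) (x y : vertex) : Prop := exists m n,
  [/\ e = (n, lcoset_of m (Aset n)),
      x.2 = (false, lcoset_of m Gset),
      y.2 = (true, lcoset_of (m * (t n)^-1) Rset) &
      y.1 = x.1 * free_gen e].

Definition vadj (x y : vertex) : Prop := exists e, arc e x y \/ arc e y x.

Definition base : vertex := (1, (true, Rset)).

Lemma vact1 x : vact 1 x = x.
Proof.
by case: x => f [b S]; rewrite /vact /= free_act_1 mul1g lcoset_of1.
Qed.

Lemma vactM g h x : vact (g * h) x = vact g (vact h x).
Proof.
by rewrite /vact /= free_act_mul free_actM lcoset_ofM mulgA.
Qed.

Lemma arc_act h e x y :
  arc e x y -> arc (edge_act (sd_quo h) e) (vact h x) (vact h y).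
Proof.
move=> [m [n [-> xE yE yxE]]]; exists (sd_quo h * m), n.
rewrite /vact /= xE yE yxE /edge_act /= -!lcoset_ofM free_actM mulgA.
by rewrite free_act_gen /edge_act /= -!lcoset_ofM !mulgA.
Qed.

Lemma vadj_act h x y : vadj x y -> vadj (vact h x) (vact h y).
Proof.
by move=> [e [xy|yx]]; exists (edge_act (sd_quo h) e);
  [left|right]; apply: arc_act.
Qed.

Lemma vadj_sym x y : vadj x y -> vadj y x.
Proof. by move=> [e [xy|yx]]; exists e; [right|left]. Qed.

Lemma vadj_ty x y : vadj x y -> y.2.1 = ~~ x.2.1.
Proof. by move=> [e [|]] [m [n [_ -> -> _]]]. Qed.

Lemma arc_source_eq e x x' y : arc e x y -> arc e x' y -> x = x'.
Proof.
move=> [m [n [-> xE _ yE]]].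
move=> [m' [n' [[<- /(lcoset_of_eq _ _ (sA n)) mm'] xE' _ yE']]].
case: x x' xE yE xE' yE' => f v [f' v'] /= -> yE -> yE'.
congr (_, (_, _)).
  by apply: (mulIg (free_gen (n, lcoset_of m (Aset n)))); rewrite -yE.
by apply/(lcoset_of_eq _ _ sG)/sub_AG/mm'.
Qed.

Lemma arc_target_eq e x y y' : arc e x y -> arc e x y' -> y = y'.
Proof.
move=> [m [n [-> _ yE yxE]]].
move=> [m' [n' [[<- /(lcoset_of_eq _ _ (sA n)) mm'] _ yE' yxE']]].
case: y y' yE yxE yE' yxE' => f v [f' v'] /= -> -> -> ->.
congr (_, (_, _)); apply/(lcoset_of_eq _ _ sR).
by have := AtR mm'; rewrite invgM invgK !mulgA.
Qed.

Lemma free_gen_inj : injective (@free_gen E).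
Proof. by move=> e e' [] /=. Qed.

Definition step x (b : E * bool) y := if b.2 then arc b.1 x y else arc b.1 y x.

Lemma step_fst x b y : step x b y -> y.1 = x.1 * free_letter b.
Proof.
case: b => e [] /= [m [n [_ _ _ yE]]]; first by rewrite yE.
by rewrite yE free_letterE mulgK.
Qed.

Lemma step_back x b y z : step x b y -> step y (flip_letter b) z -> x = z.
Proof.
case: b => e []; rewrite /step /=; first exact: arc_source_eq.
exact: arc_target_eq.
Qed.

(** Along a walk the free group coordinate is multiplied by one letter per step. By [step_back] two
    cancelling letters mean a backtrack, so a reduced walk spells a reduced word, which is not
    [1]. *)
Lemma vadj_acyclic : acyclic vadj.
Proof.
move=> p n rp n_gt0 pn.
(* The last letter [b] is kept apart, since the induction compares it with the next one. *)
suff [w [b [rw pw _]]] : exists w b,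
    [/\ reduced_word (rcons w b), (p n).1 = (p 0%N).1 * word_val (rcons w b) &
        step (p n.-1) b (p n)].
  apply: (word_val_neq1 rw); first by case: (w).
  by apply: (mulgI (p 0%N).1); rewrite -pw -pn mulg1.
have vadj_step x y : vadj x y -> exists b, step x b y.
  by move=> [e [xy|yx]]; [exists (e, true)|exists (e, false)].
case: n n_gt0 rp {pn} => // n _; elim: n => [|n IHn] [wp rp].
  have [b pb] := vadj_step _ _ (wp 0%N isT).
  by exists [::], b; split=> //=; rewrite mulg1 (step_fst pb).
have [|w [b [rw pw pb]]] := IHn.
  by split=> i i_lt; [apply: wp|apply: rp]; lia.
have [c pc] := vadj_step _ _ (wp n.+1 (ltnSn _)).
exists (rcons w b), c; split=> //; last first.
  by rewrite word_val_rcons mulgA -pw (step_fst pc).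
have cb : c != flip_letter b.
  apply/eqP => cb; rewrite cb in pc.
  by apply: (rp n _ (step_back pb pc)); lia.
move: rw; rewrite /reduced_word; case: w pw => [|d w] pw /=; first by rewrite cb.
by rewrite !rcons_path last_rcons cb andbT.
Qed.

(** The two ends differ by the generator of the edge, and distinct edges have distinct
    generators. *)
Lemma fix_arc h e x y : arc e x y -> vact h x = x -> vact h y = y ->
  edge_act (sd_quo h) e = e.
Proof.
move=> [m [n [_ _ _ yE]]] hx hy; apply: free_gen_inj; rewrite -free_act_gen.
have := congr1 fst hy; rewrite /= yE free_actM mulgA => hy1.
by apply: (mulgI x.1); rewrite -hy1; congr (_ * _); have := congr1 fst hx.
Qed.

Lemma vact_quo1 h x : sd_quo h = 1 -> vact h x = x -> h = 1.
Proof.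
move=> h1 hx; apply: semidirect_eq => //=.
have := congr1 fst hx; rewrite /= h1 free_act_1 => e.
by apply: (mulIg x.1); rewrite e mul1g.
Qed.

(** Both edges issue from [y], which lies over some [m G]. If [h] fixes them, it gives an element of
    [G] lying in conjugates of [<a n>] and [<a n'>]; unless it is trivial, [separated] makes the
    edges equal. *)
Lemma vact_fix_edges h x y z : vadj x y -> vadj y z -> x <> z ->
  y.2.1 = false -> vact h x = x -> vact h y = y -> vact h z = z -> h = 1.
Proof.
move=> xy yz xz ty hx hy hz.
have [e yx] : exists e, arc e y x.
  by move: xy => [e [[m [n [_ _ yE _]]]|yx]]; [rewrite yE in ty|exists e].
have [e' yz'] : exists e, arc e y z.
  by move: yz => [e' [yz'|[m [n [_ _ yE _]]]]]; [exists e'|rewrite yE in ty].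
apply: (vact_quo1 _ hy); apply: contrapT => q_neq1.
have he := fix_arc yx hy hx; have he' := fix_arc yz' hy hz.
apply: xz; suff ee' : e = e' by rewrite ee' in yx; apply: arc_target_eq yx yz'.
move: he he'; move: yx yz' => [m [n [-> yE _ _]]] [m' [n' [-> yE' _ _]]].
have /(lcoset_of_eq _ _ sG)[g _ mm'] : lcoset_of m Gset = lcoset_of m' Gset.
  by move: yE; rewrite yE' => -[].
move=> [/(lcoset_of_fix (sA n))[p pE]] [/(lcoset_of_fix (sA n'))[q qE]].
have m'E : m' = m * j g by rewrite mm' mulVKg.
have a_neq1 : zpow (a n) p <> 1.
  move=> ap; apply: q_neq1; move: pE; rewrite -jX ap (morph_1 jM) -mulgA => pE.
  by apply: (mulIg m); apply: (mulgI m^-1); rewrite pE mul1g mulVg.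
have conj_eq : zpow (a n) p ^ g = zpow (a n') q.
  apply: j_inj; rewrite (morph_J jM) !jX -pE -qE m'E conjgE invgM.
  by rewrite !mulgA.
have [nn' [z' gE]] := separated a_neq1 conj_eq.
rewrite -nn'; congr (_, _); apply/(lcoset_of_eq _ _ (sA n)).
by exists z'; rewrite -mm' gE jX.
Qed.

(** Over [m G], the element [h] acts as the conjugate of some [g] in [G]. By [cover], [g] lies in a
    conjugate of some [<a n>], which stabilizes an edge at [x]. *)
Lemma vact_fix_false h x y : vadj y x -> x.2.1 = false -> vact h x = x ->
  exists2 z, vadj x z & vact h z = z.
Proof.
move=> yx tx hx.
(* The neighbour [y] certifies that the label of [x] is a coset of [G]. *)
have [m xE] : exists m, x.2 = (false, lcoset_of m Gset).
  by move: yx tx => [e [|]] [m [n [_ xE yE _]]]; [rewrite yE|exists m].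
have := congr1 (snd \o snd) hx; rewrite /= xE => /(lcoset_of_fix sG)[g _ gE].
have [n [u [z gz]]] := cover g.
pose m1 := m * j u^-1; pose e : E := (n, lcoset_of m1 (Aset n)).
pose y1 : vertex := (x.1 * free_gen e, (true, lcoset_of (m1 * (t n)^-1) Rset)).
have xy1 : arc e x y1.
  exists m1, n; split=> //; rewrite xE; congr (_, _).
  by apply/(lcoset_of_eq _ _ sG); rewrite mulKg; exists u^-1.
have qm1 : sd_quo h * m1 = m1 * zpow (j (a n)) z.
  have -> : sd_quo h = m * j g * m^-1 by rewrite gE !mulgA mulgV mul1g mulgK.
  rewrite gz (morph_J jM) jX conjgE /m1 (morph_V jM).
  by rewrite !mulgA mulgVK mulgK.
exists y1; first by exists e; left.
have he : edge_act (sd_quo h) e = e.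
  congr (_, _); rewrite /= -lcoset_ofM; apply/esym/(lcoset_of_eq _ _ (sA n)).
  by rewrite qm1 mulKg; exists z.
rewrite /vact /= free_actM free_act_gen he mulgA.
have /= -> := congr1 fst hx; congr (_, (_, _)).
rewrite -lcoset_ofM mulgA qm1; apply/esym/(lcoset_of_eq _ _ sR).
have : Aset n (zpow (j (a n)) z) by exists z.
have divKK (b c d : M) : (b * c^-1)^-1 * (b * d * c^-1) = c * d * c^-1.
  by rewrite invgM invgK !mulgA mulgVK.
by move/AtR; rewrite divKK.
Qed.

(** Conjugation by [m] puts the image of the stabilizer into [<r>], and [phi] is the exponent; the
    kernel is trivial by [vact_quo1]. *)
Lemma vact_stab_true x m : x.2 = (true, lcoset_of m Rset) ->
  exists phi : L -> int,
    (forall g h, vact g x = x -> vact h x = x ->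
       phi (g * h) = (phi g + phi h)%R) /\
    (forall h, vact h x = x -> phi h = 0%R -> h = 1).
Proof.
move=> xE.
have r_inj z w : zpow r z = zpow r w -> z = w.
  move=> e; have : zpow r (z - w)%R = 1 by rewrite zpowD zpowN e mulgV.
  by move/r_free; lia.
have [phi phiP] : exists phi : L -> int,
    forall h, vact h x = x -> m^-1 * sd_quo h * m = zpow r (phi h).
  have /choice[phi phiP] : forall h : L, exists z : int,
      vact h x = x -> m^-1 * sd_quo h * m = zpow r z.
    move=> h; have [hx|nhx] := pselect (vact h x = x); last by exists 0%R.
    have := congr1 (snd \o snd) hx; rewrite /= xE => /(lcoset_of_fix sR)[z zE].
    by exists z.
  by exists phi.
exists phi; split=> [g h gx hx|h hx h0].
  apply: r_inj; rewrite -phiP; last by rewrite vactM hx.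
  by rewrite zpowD -!phiP //= !mulgA mulgK.
apply: (vact_quo1 _ hx); have := phiP h hx; rewrite h0 zpow0 => e.
by apply: (mulgI m^-1); apply: (mulIg m); rewrite e mulg1 mulVg.
Qed.

Let e_ n : F := free_gen (n, Aset n).
Let sd_M (m : M) : L := Semidirect free_action 1 m.
Let sd_F (f : F) : L := Semidirect free_action f 1.

Let sd_MM : {morph sd_M : x y / x * y}.
Proof.
by move=> x y; apply: semidirect_eq => //=; rewrite (morph_1 (free_actM _)) mulg1.
Qed.

Let sd_FM : {morph sd_F : x y / x * y}.
Proof. by move=> x y; apply: semidirect_eq; rewrite /= ?free_act_1 ?mulg1. Qed.

Lemma sd_MF m f : sd_M m * sd_F f = sd_F (free_act m f) * sd_M m.
Proof.
apply: semidirect_eq; rewrite /= ?mulg1 ?mul1g //.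
Qed.

(** The lifts are chosen by their effect near [base]: [core_root] fixes [base], the image of
    [core_iota] fixes its neighbour [base1], and [core_tau n] moves [base1] to a neighbour of
    [base]. *)
Definition core_iota (g : G) : L := sd_M (j g) ^ sd_F (e_ 0%N).
Definition core_root : L := sd_M r.
Definition core_tau n : L := sd_M (t n) * sd_F ((e_ n)^-1 * e_ 0%N).

Lemma core_iotaM : {morph core_iota : x y / x * y}.
Proof. by move=> x y; rewrite /core_iota jM sd_MM conjMg. Qed.

(** The coset [Aset n] is stabilized by [a n]. This commutation is what lifts the relations from
    [M]. *)
Lemma edge_fix n : sd_M (j (a n)) * sd_F (e_ n) = sd_F (e_ n) * sd_M (j (a n)).
Proof.
rewrite sd_MF free_act_gen; congr (sd_F (free_gen (_, _)) * _).
rewrite /= -[RHS]lcoset_of1; apply/esym/(lcoset_of_eq _ _ (sA n)).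
by rewrite invg1 mul1g; exists 1%R.
Qed.

Lemma core_iota_a n : core_iota (a n) = sd_M (j (a n)) ^ sd_F ((e_ n)^-1 * e_ 0%N).
Proof.
rewrite sd_FM conjgM; congr (_ ^ _).
rewrite (morph_V sd_FM) conjgE invgK -[in RHS](mulgVK (sd_F (e_ n)) (sd_M _ * _)).
by rewrite -mulgA mulVg mulg1 mulgA -edge_fix mulgK.
Qed.

Lemma core_rootX : core_root ^+ k = core_iota (a 0%N).
Proof.
by rewrite core_iota_a mulVg (morph_1 sd_FM) conjg1 -ra0 (morph_X sd_MM).
Qed.

Lemma core_root_tau n : a n <> 1 ->
  core_root ^+ k * core_tau n = core_tau n * core_iota (a n).
Proof.
move=> an_neq1.
rewrite core_iota_a /core_tau /core_root -(morph_X sd_MM) mulgA -sd_MM rt // sd_MM.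
by rewrite -!mulgA -conjgC.
Qed.

Definition core_gens : set L :=
  [set h | h = core_root \/ (exists n, h = core_tau n) \/
           exists g, h = core_iota g].

Definition core_group : groupType :=
  subgroup_of (generated_by_subgroup core_gens).

Lemma core_base_act m : Rset m -> vact (sd_M m) base = base.
Proof.
move=> Rm; rewrite /vact /= (morph_1 (free_actM _)) mulg1; congr (_, (_, _)).
by rewrite -[RHS]lcoset_of1; apply/esym/(lcoset_of_eq _ _ sR); rewrite invg1 mul1g.
Qed.

Let base1 : vertex := ((e_ 0%N)^-1, (false, Gset)).

Lemma base1_arc : arc (0%N, Aset 0%N) base1 base.
Proof.
exists 1, 0%N; rewrite /base /base1 /= !lcoset_of1 t0 invg1 mulg1 lcoset_of1.
by rewrite mulVg.
Qed.

Lemma core_tau_arc n : vadj (vact (core_tau n) base1) base.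
Proof.
pose x : vertex := ((e_ n)^-1, (false, Gset)).
pose y : vertex := (1, (true, lcoset_of (t n)^-1 Rset)).
have xy : arc (n, Aset n) x y.
  by exists 1, n; rewrite /x /y /= !lcoset_of1 mul1g mulVg.
have -> : vact (core_tau n) base1 = vact (sd_M (t n)) x.
  rewrite vactM; congr vact; rewrite /vact /= free_act_1 mulgK.
  by rewrite lcoset_of1.
have -> : base = vact (sd_M (t n)) y.
  rewrite /vact /= (morph_1 (free_actM _)) mulg1 -lcoset_ofM mulgV.
  by rewrite lcoset_of1.
by apply: vadj_act; exists (n, Aset n); left.
Qed.

Lemma core_iota_fix g : vact (core_iota g) base1 = base1.
Proof.
have base1E : base1 = vact (sd_F (e_ 0%N)^-1) (1, (false, Gset)).
  by rewrite /vact /= free_act_1 mulg1 lcoset_of1.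
rewrite base1E -vactM /core_iota conjgE (morph_V sd_FM) -!mulgA mulgV mulg1.
rewrite vactM; congr vact; rewrite /vact /= (morph_1 (free_actM _)) mulg1.
congr (_, (_, _)); rewrite -[RHS]lcoset_of1; apply/esym/(lcoset_of_eq _ _ sG).
by rewrite invg1 mul1g; exists g.
Qed.

Let conn x y := exists n, connected vadj n x y.

(** The elements that keep [base] in its component form a subgroup, and each generator moves [base]
    or its neighbour [base1] by at most one edge. *)
Lemma core_connected (h : core_group) : conn base (vact (sgval h) base).
Proof.
have conn_sym x y : conn x y -> conn y x.
  by move=> [n c]; exists n; apply: connected_sym c; apply: vadj_sym.
have conn_trans y x z : conn x y -> conn y z -> conn x z.
  by move=> [n c] [m d]; exists (n + m)%N; apply: connected_trans d.
have conn_actx g x y : conn x y -> conn (vact g x) (vact g y).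
  by move=> [n c]; exists n; apply: connected_act c; apply: vadj_act.
have conn_adj x y : vadj x y -> conn x y.
  move=> xy; exists 1%N, (fun i => if i is 0%N then x else y).
  by split=> // -[].
have conn_base1 : conn base1 base by apply: conn_adj; eexists; left; apply: base1_arc.
apply: (sgvalP h [set h | conn base (vact h base)]); split.
  split=> [|g1 g2 c1 c2|g c] /=.
  - by rewrite vact1; exists 0%N, (fun=> base).
  - by rewrite vactM; apply: (conn_trans _ _ _ c1); apply: conn_actx.
  - apply: conn_sym; have := conn_actx g^-1 _ _ c.
    by rewrite -vactM mulVg vact1.
move=> g [->|[[n ->]|[g' ->]]] /=.
- rewrite core_base_act; first by exists 0%N, (fun=> base).
  by exists 1%R.
- apply: (conn_trans (vact (core_tau n) base1)); last exact: conn_actx.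
  by apply: conn_sym; apply: conn_adj; apply: core_tau_arc.
- apply: (conn_trans base1); first exact: conn_sym.
  by rewrite -{1}(core_iota_fix g'); apply: conn_actx.
Qed.

Lemma core_axial : axial core_group.
Proof.
have conn_prev x : conn base x -> x = base \/ exists y, vadj y x.
  move=> [[|n] [p [wp p0 pn]]]; first by left; rewrite -pn.
  by right; exists (p n); rewrite -pn; apply: wp.
apply: (@forest_action_axial _ _ (fun h => vact (sgval h)) vadj
  (fun x => x.2.1) base).
- exact: vact1.
- by move=> g h x; rewrite -vactM.
- exact: vadj_sym.
- by move=> h x y; apply: vadj_act.
- exact: vadj_ty.
- by [].
- exact: vadj_acyclic.
- exact: core_connected.
- move=> h x y z xy yz xz ty hx hy hz; apply: sgval_inj.
  exact: (vact_fix_edges xy yz xz ty hx hy hz).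
- move=> h x /conn_prev[->//|[y yx]] tx hx.
  exact: vact_fix_false yx tx hx.
- move=> x cx tx.
  have [m xE] : exists m, x.2 = (true, lcoset_of m Rset).
    case: (conn_prev _ cx) tx => [->|[y [e [|]] [m [n [_ yE xE _]]]] tx].
    + by exists 1; rewrite lcoset_of1.
    + by exists (m * (t n)^-1).
    + by rewrite yE in tx.
  have [phi [phiD phi_inj]] := vact_stab_true xE.
  exists (phi \o @sgval _ _ _); split=> [g h gx hx|h hx h0] /=.
    by rewrite phiD.
  by apply: sgval_inj; apply: phi_inj.
Qed.

(** The map [q] back to [M] serves to detect that [iota] is injective and that a subgroup is free;
    the last clause says that [root], the [tau n] and the image of [iota] generate. *)
Theorem core_construction :
  exists (H : groupType) (iota : G -> H) (root : H) (tau : nat -> H) (q : H -> M),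
    [/\ axial H,
        {morph iota : x y / x * y} /\ {morph q : x y / x * y},
        [/\ forall g, q (iota g) = j g, q root = r & forall n, q (tau n) = t n],
        [/\ root ^+ k = iota (a 0%N), tau 0%N = 1 &
            forall n, a n <> 1 -> root ^+ k * tau n = tau n * iota (a n)] &
        forall S : set H, is_subgroup S -> S root -> (forall n, S (tau n)) ->
          (forall g, S (iota g)) -> S = setT].
Proof.
have gen_in h : core_gens h -> generated_by core_gens h.
  exact: sub_gen_smallest.
have root_in : generated_by core_gens core_root by apply: gen_in; left.
have tau_in n : generated_by core_gens (core_tau n).
  by apply: gen_in; right; left; exists n.
have iota_in g : generated_by core_gens (core_iota g).
  by apply: gen_in; right; right; exists g.
pose mk h (hP : generated_by core_gens h) : core_group :=
  SubgroupOf (generated_by_subgroup core_gens) hP.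
exists core_group, (fun g => mk _ (iota_in g)), (mk _ root_in),
  (fun n => mk _ (tau_in n)), (@sd_quo _ _ _ \o @sgval _ _ _).
have sgvalX (x : core_group) n : sgval (x ^+ n) = sgval x ^+ n.
  exact: (morph_X (@sgvalM _ _ _)).
split.
- exact: core_axial.
- by split=> // x y; apply: sgval_inj; apply: core_iotaM.
- split=> // [g|n] /=; last by rewrite mulg1.
  by rewrite !invg1 mul1g mulg1.
- split=> [||n an_neq1]; apply: sgval_inj.
  + by rewrite sgvalX; apply: core_rootX.
  + by rewrite /= /core_tau t0 mulVg (morph_1 sd_MM) (morph_1 sd_FM) mulg1.
  + by rewrite sgvalM sgvalX; apply: core_root_tau.
- move=> S [S1 SM SV] Sr St Si; apply/seteqP; split=> // h _.
  have [S' [sS' S'E]] : exists S' : set L, is_subgroup S' /\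
      forall h, S' h <-> exists2 x : core_group, S x & sgval x = h.
    exists [set h | exists2 x : core_group, S x & sgval x = h]; split=> //.
    split=> [|_ _ [x Sx <-] [y Sy <-]|_ [x Sx <-]].
    + by exists 1.
    + by exists (x * y); [apply: SM|].
    + by exists x^-1; [apply: SV|].
  have /S'E[x Sx /sgval_inj <-//] : S' (sgval h).
  apply: (sgvalP h); split=> // _ [->|[[n ->]|[g ->]]]; apply/S'E.
  + by exists (mk _ root_in).
  + by exists (mk _ (tau_in n)).
  + by exists (mk _ (iota_in g)).
Qed.

End Core.

(** * Maximal abelian subgroups of CSA-groups *)

Lemma conj_setM (G : groupType) (A : set G) g h :
  conj_set (conj_set A g) h = conj_set A (g * h).
Proof.
apply/seteqP; split=> [_ [_ [x Ax <-] <-]|_ [x Ax <-]].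
  by exists x => //; rewrite conjgM.
by exists (x ^ g); [exists x|rewrite conjgM].
Qed.

Lemma conj_set1 (G : groupType) (A : set G) : conj_set A 1 = A.
Proof.
apply/seteqP; split=> [_ [x Ax <-]|x Ax]; first by rewrite conjg1.
by exists x => //; rewrite conjg1.
Qed.

Lemma max_abelian_exists (G : groupType) (g : G) :
  exists2 A : set G, maximal_abelian A & A g.
Proof.
pose P (A : set G) := A = set0 \/ [/\ is_subgroup A, is_abelian A & A g].
have [F FP totF|A [PA maxA]] := @Zorn_bigcup _ P.
  have [F0|[C FC C_neq0]] : (forall A, F A -> A = set0) \/
      exists2 A, F A & A <> set0.
  - have [|nex] := pselect (exists2 A, F A & A <> set0); first by right.
    by left=> A FA; apply: contrapT => A0; apply: nex; exists A.
  - by left; apply/seteqP; split=> // x [A /F0 ->].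
  have FP' A : F A -> A <> set0 -> [/\ is_subgroup A, is_abelian A & A g].
    by move=> /FP[].
  have FPx A x : F A -> A x -> [/\ is_subgroup A, is_abelian A & A g].
    by move=> FA Ax; apply: FP' => // A0; rewrite A0 in Ax.
  have FPxy x y : (\bigcup_(A in F) A) x -> (\bigcup_(A in F) A) y ->
      exists A, [/\ F A, A x & A y].
    move=> [A FA Ax] [B FB By].
    by have [AB|BA] := totF A B FA FB; [exists B|exists A]; split; auto.
  have [[C1 _ _] _ Cg] := FP' _ FC C_neq0.
  right; split; [split| |].
  - by exists C.
  - move=> x y /FPxy Ux /Ux[A [FA Ax Ay]]; have [[_ AM _] _ _] := FPx A x FA Ax.
    by exists A => //; apply: AM.
  - move=> x [A FA Ax]; have [[_ _ AV] _ _] := FPx A x FA Ax.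
    by exists A => //; apply: AV.
  - move=> x y /FPxy Ux /Ux[A [FA Ax Ay]]; have [_ abA _] := FPx A x FA Ax.
    exact: abA.
  - by exists C.
have gP : P (generated_by [set g]).
  right; split; [exact: generated_by_subgroup|exact: generated_by_zpow_abelian|].
  by apply/generated_by1P; exists 1%R.
case: PA => [A0|[sA abA Ag]].
  by case: (maxA _ _ gP); rewrite A0; split=> // /(_ g); apply;
    apply/generated_by1P; exists 1%R.
exists A => //; split=> // B sB abB AB; apply/seteqP; split=> //.
apply: contrapT => nBA; apply: (maxA B) => //.
by right; split=> //; apply: AB.
Qed.

Section CSA.
Variables (G : groupType) (a0 : G).
Hypothesis G_countable : countable [set: G].
Hypothesis G_torsion_free : torsion_free G.
Hypothesis G_CSA : is_CSA G.
Hypothesis G_max_abelian_cyclic : max_abelian_cyclic G.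
Hypothesis ha0 : maximal_abelian (generated_by [set a0]).
Hypothesis a0_neq1 : a0 <> 1.

Implicit Types (x y : G) (A B : set G).

Let cyc x := generated_by [set x].

Lemma cyc_id x : cyc x x.
Proof. by apply/generated_by1P; exists 1%R. Qed.

(** The element [w] lies in both [A] and its conjugate by [x], so malnormality applies. *)
Lemma max_abelian_commute A w x :
  maximal_abelian A -> A w -> w <> 1 -> w ^ x = w -> A x.
Proof.
move=> maxA Aw w_neq1 wx; apply: G_CSA => // e.
have : (A `&` conj_set A x) w by split=> //; exists w.
by rewrite e.
Qed.

Lemma max_abelian_eq A B w : maximal_abelian A -> maximal_abelian B ->
  A w -> B w -> w <> 1 -> A = B.
Proof.
move=> maxA maxB Aw Bw w_neq1; have [sA abA _] := maxA; have [_ _ maxB'] := maxB.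
have [sB abB _] := maxB; apply/seteqP; split=> x Hx.
  by apply: (max_abelian_commute maxB Bw) => //; rewrite conjgE (abA w x) ?mulKg.
by apply: (max_abelian_commute maxA Aw) => //; rewrite conjgE (abB w x) ?mulKg.
Qed.

Lemma max_abelian_conj A u : maximal_abelian A -> maximal_abelian (conj_set A u).
Proof.
have conjP (B : set G) v : is_subgroup B -> is_abelian B ->
    is_subgroup (conj_set B v) /\ is_abelian (conj_set B v).
  move=> [B1 BM BV] abB; split.
    split=> [|_ _ [x Bx <-] [y By <-]|_ [x Bx <-]].
    - by exists 1 => //; rewrite conj1g.
    - by exists (x * y); [apply: BM|rewrite conjMg].
    - by exists x^-1; [apply: BV|rewrite conjVg].
  by move=> _ _ [x Bx <-] [y By <-]; rewrite /commute -!conjMg abB.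
move=> [sA abA maxA]; have [sAu abAu] := conjP A u sA abA.
split=> // B sB abB AB; have [sB' abB'] := conjP B u^-1 sB abB.
have := maxA _ sB' abB'; rewrite -[in A `<=` _](conj_set1 A) -(mulgV u) -conj_setM.
move=> /(_ _)/(congr1 (fun C => conj_set C u)) => <-.
  by rewrite conj_setM mulVg conj_set1.
by move=> _ [x Ax <-]; exists x => //; apply: AB.
Qed.

Lemma max_abelian_neq1 A : maximal_abelian A -> exists2 x, x <> 1 & A = cyc x.
Proof.
move=> maxA; have [x Ax] := G_max_abelian_cyclic maxA; exists x => // x1.
have [_ _ /(_ (cyc a0))] := maxA; rewrite Ax => AE.
have A0 : cyc a0 = cyc x.
  apply: AE; [exact: generated_by_subgroup|exact: generated_by_zpow_abelian|].
  move=> _ /generated_by1P[z ->]; rewrite x1 zpow1n.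
  by have [] := generated_by_subgroup [set a0].
have := @cyc_id a0; rewrite A0 => /generated_by1P[z].
by rewrite x1 zpow1n.
Qed.

(* One generator is chosen in each conjugacy class of maximal abelian
   subgroups; the unused indices are filled with [1]. *)
Lemma max_abelian_reps : exists a : nat -> G,
  [/\ a 0%N = a0,
      (forall A, maximal_abelian A ->
         exists n u, a n <> 1 /\ conj_set A u = cyc (a n)) &
      (forall n m x p q, zpow (a n) p <> 1 ->
         zpow (a n) p ^ x = zpow (a m) q ->
         n = m /\ exists t, x = zpow (a n) t)].
Proof.
have [c c_inj] := countable_injP _ G_countable.
pose MA x := x <> 1 /\ maximal_abelian (cyc x).
pose cl x := [set y | MA y /\ exists u, conj_set (cyc x) u = cyc y].
have cl_sub x y u : conj_set (cyc x) u = cyc y -> cl y `<=` cl x.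
  move=> xy z [MAz [v yz]]; split=> //; exists (u * v).
  by rewrite -conj_setM xy.
have cl_eq x y u : conj_set (cyc x) u = cyc y -> cl x = cl y.
  move=> xy; apply/seteqP; split; last exact: cl_sub xy.
  by apply: (@cl_sub y x u^-1); rewrite -xy conj_setM mulgV conj_set1.
(* The representative of a class depends only on the class, and it is [a0] where possible. *)
pose rep (S : set G) := if pselect (S a0) then a0 else xget 1 S.
have repP x : MA x -> cl x (rep (cl x)).
  move=> MAx; rewrite /rep; case: pselect => [//|?]; apply: xgetPex.
  by exists x; split=> //; exists 1; rewrite conj_set1.
have MA0 : MA a0 by [].
have rep0 : rep (cl a0) = a0.
  rewrite /rep; case: pselect => // -[]; split=> //; exists 1.
  by rewrite conj_set1.
pose P n x := [/\ MA x, rep (cl x) = x & c x = n].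
(* Index 0 is reserved for [a0]; another representative [x] sits at [(c x).+1], with [c] an
   injection of [G] into the naturals. Excluding [a0] there keeps indices unique. *)
pose a n := if n is n'.+1 then
  (if pselect (exists2 x, P n' x & x <> a0) is left _
   then xget 1 [set x | P n' x /\ x <> a0] else 1) else a0.
have aP n : a n.+1 <> 1 -> P n (a n.+1) /\ a n.+1 <> a0.
  rewrite /a; case: pselect => [[x Px x_neq]|//] _.
  by apply: (@xgetPex _ 1 [set x | P n x /\ x <> a0]); exists x.
have aMA n : a n <> 1 -> MA (a n) /\ rep (cl (a n)) = a n.
  by case: n => [//|n] /aP[[]].
exists a; split=> //.
- move=> A maxA; have [x x_neq1 Ax] := max_abelian_neq1 maxA.
  have MAx : MA x by split=> //; rewrite -Ax.
  have [MAy [u xy]] := repP _ MAx; set y := rep (cl x) in MAy xy.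
  have [ya0|ya0] := pselect (y = a0).
    by exists 0%N, u; rewrite Ax xy ya0.
  have Py : P (c y) y by split=> //; rewrite -(cl_eq _ _ _ xy).
  have any : a (c y).+1 = y.
    rewrite /a; case: pselect => [ex|[]]; last by exists y.
    have [|[_ _ ce] _] := @xgetPex _ 1 [set x | P (c y) x /\ x <> a0].
      by exists y.
    by apply: c_inj; rewrite ?in_setE.
  by exists (c y).+1, u; rewrite any Ax xy; split=> //; case: MAy.
- move=> n m x p q anp_neq1 e.
  have an_neq1 : a n <> 1 by move=> an1; apply: anp_neq1; rewrite an1 zpow1n.
  have w_neq1 : zpow (a n) p ^ x <> 1.
    by move/eqP; rewrite conjg_eq1 => /eqP.
  have am_neq1 : a m <> 1 by move=> am1; apply: w_neq1; rewrite e am1 zpow1n.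
  have [[_ maxn] repn] := aMA n an_neq1; have [[_ maxm] repm] := aMA m am_neq1.
  have nm : conj_set (cyc (a n)) x = cyc (a m).
    apply: (max_abelian_eq (max_abelian_conj x maxn) maxm _ _ w_neq1).
      by exists (zpow (a n) p) => //; apply/generated_by1P; exists p.
    by rewrite e; apply/generated_by1P; exists q.
  have anm : a n = a m by rewrite -repn -repm (cl_eq _ _ _ nm).
  split.
    case: n m an_neq1 am_neq1 anm {anp_neq1 e w_neq1 maxn repn maxm repm nm} =>
      [|n] [|m] //.
    - by move=> _ /aP[_ am_neq] /esym.
    - by move=> /aP[_ an_neq] _.
    - by move=> /aP[[_ _ cn] _] /aP[[_ _ cm] _] e; rewrite -cn e cm.
  suff : cyc (a n) x by move=> /generated_by1P.
  apply: (G_CSA maxn) => /seteqP[sub1 _]; apply: w_neq1; apply: sub1; split.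
    by rewrite e anm; apply/generated_by1P; exists q.
  by exists (zpow (a n) p) => //; apply/generated_by1P; exists p.
Qed.

(* Both sides are free [<x>]-sets with countably infinitely many orbits. *)
Lemma shift_bijection x : x <> 1 ->
  exists (f : G * nat -> int * nat) (f' : int * nat -> G * nat),
    [/\ cancel f f', cancel f' f &
        forall g n, f (x * g, n) = ((f (g, n)).1 + 1, (f (g, n)).2)%R].
Proof.
move=> x_neq1.
have x_free z : zpow x z = 1 -> z = 0%R.
  case: z => [[//|n]|n] /=; first by move/G_torsion_free => /(_ isT).
  by move/eqP; rewrite invg_eq1 => /eqP /G_torsion_free => /(_ isT).
pose orb g := [set y | exists z, y = zpow x z * g].
pose rep g := xget 1 (orb g).
have repP g : orb g (rep g).
  by apply: xgetPex; exists g, 0%R; rewrite zpow0 mul1g.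
have orbM z g : orb (zpow x z * g) = orb g.
  apply/seteqP; split=> y [w ->].
    by exists (w + z)%R; rewrite zpowD mulgA.
  by exists (w - z)%R; rewrite zpowD zpowN mulgA mulgVK.
have repM z g : rep (zpow x z * g) = rep g by rewrite /rep orbM.
have rep_id g : rep (rep g) = rep g.
  by have [z zE] := repP g; rewrite {1}zE repM.
have /choice[zeta zetaP] : forall g, exists z, g = zpow x z * rep g.
  move=> g; have [z zE] := repP g; exists (- z)%R.
  by rewrite zE mulgA -zpowD GRing.addNr zpow0 mul1g.
have zetaM z g : zeta (zpow x z * g) = (z + zeta g)%R.
  have := zetaP (zpow x z * g); rewrite repM {1}(zetaP g) mulgA -zpowD.
  move=> /mulIg e; have : zpow x (z + zeta g - zeta (zpow x z * g)%g)%R = 1.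
    by rewrite zpowD zpowN e mulgV.
  by move/x_free; lia.
have zeta_rep y : rep y = y -> zeta y = 0%R.
  move=> ry; have := zetaP y; rewrite ry -{1}[y]mul1g => /mulIg/esym.
  exact: x_free.
pose R := [set y | rep y = y].
(* The factor [nat] makes the set of orbits infinite even when [<x>] has finite index in [G]. *)
have /card_set_bijP[gam gam_bij] : ([set: nat] `*`` (fun=> R) #= [set: nat])%card.
  apply: cardXR_eq_nat => // _; split.
    by apply: sub_countable G_countable; apply: subset_card_le.
  by exists (rep 1); apply: rep_id.
have [_ gam_inj gam_surj] := gam_bij.
have /choice[del delP] : forall m, exists d : nat * G,
    rep d.2 = d.2 /\ gam d = m.
  by move=> m; have [d [_ Rd] <-] := gam_surj m I; exists d.
pose f (u : G * nat) := (zeta u.1, gam (u.2, rep u.1)).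
pose f' (v : int * nat) := (zpow x v.1 * (del v.2).2, (del v.2).1).
exists f, f'; split.
- move=> [g n]; rewrite /f /f' /=; have [rd gd] := delP (gam (n, rep g)).
  have -> : del (gam (n, rep g)) = (n, rep g).
    by apply: gam_inj gd; rewrite in_setE; split=> //=; apply: rep_id.
  by rewrite -zetaP.
- move=> [z m]; rewrite /f /f' /=; have [rd gd] := delP m.
  rewrite zetaM repM zeta_rep // rd GRing.addr0; congr (_, _).
  by rewrite -[in RHS]gd; case: (del m).
- move=> g n; rewrite /f /=; have := repM 1%R g; have := zetaM 1%R g.
  by rewrite zpow1 => -> ->; rewrite GRing.addrC.
Qed.

End CSA.

(** * A permutation group containing the star of cyclic groups *)

Section Model.
Variables (k : nat) (G : groupType) (a0 : G).
Hypothesis k_gt0 : (0 < k)%N.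
Hypothesis G_countable : countable [set: G].
Hypothesis G_torsion_free : torsion_free G.
Hypothesis a0_neq1 : a0 <> 1.

Definition int_shift : permutation (int * nat).
Proof.
by exists (fun u => (u.1 + 1, u.2)%R) (fun u => (u.1 - 1, u.2)%R) => -[z m] /=;
  rewrite ?GRing.addrK ?GRing.subrK.
Defined.

Lemma int_shiftX n u : (int_shift ^+ n) u = (u.1 + Posz n, u.2)%R.
Proof.
elim: n => [|n IHn]; first by case: u => z m; rewrite /= GRing.addr0.
by rewrite expgS permME IHn /=; congr (_, _); lia.
Qed.

Lemma int_shift_free z : zpow int_shift z = 1 -> z = 0%R.
Proof.
have free n : int_shift ^+ n = 1 -> n = 0%N.
  by move=> /(congr1 (fun s : permutation _ => (s (0%R, 0%N)).1));
    rewrite int_shiftX /=; lia.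
case: z => n /=; first by move/free ->.
by move/eqP; rewrite invg_eq1 => /eqP /free.
Qed.

(** Each orbit of [int_shift] splits into [k] orbits of its power [k], one per residue class; [h]
    uses [m %% k] as the residue and [m %/ k] as the number of the large orbit. *)
Lemma shift_bijection_root (x : G) : x <> 1 ->
  exists (f : G * nat -> int * nat) (f' : int * nat -> G * nat),
    [/\ cancel f f', cancel f' f &
        forall g n, f (x * g, n) = (int_shift ^+ k) (f (g, n))].
Proof.
move=> /(shift_bijection G_countable G_torsion_free)[f [f' [fK f'K fx]]].
have k_neq0 : (Posz k != 0)%R by lia.
pose h (u : int * nat) := (u.1 * k + Posz (u.2 %% k)%N, (u.2 %/ k)%N)%R.
pose h' (u : int * nat) := (divz u.1 k, (u.2 * k + absz (modz u.1 k))%N).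
have hK : cancel h h'.
  move=> [z m]; rewrite /h /h' /= divzMDl // modzMDl.
  have m_lt : (m %% k < k)%N by rewrite ltn_mod.
  rewrite divz_small ?modz_small; try by lia.
  by rewrite GRing.addr0 /= -divn_eq.
have h'K : cancel h' h.
  move=> [z m]; rewrite /h /h' /=.
  have r_ge0 : (0 <= modz z k)%R by apply: modz_ge0.
  have r_lt : (modz z k < Posz k)%R by apply: ltz_pmod.
  rewrite modnMDl divnMDl // modn_small ?divn_small; try by lia.
  by rewrite addn0 [in RHS](divz_eq z k); congr ((_ + _)%R, _); lia.
exists (h \o f), (f' \o h'); split; [exact: can_comp|exact: can_comp|] => g n.
by rewrite int_shiftX /= fx /h /=; congr (_, _); lia.
Qed.

(** The bijection [f n] turns left multiplication by [a n] into the power [k] of the shift. Letting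
    [G] act through [f 0] and [t n] be [f n] after the inverse of [f 0] yields the relations. The
    direct factor [Q] provides a quotient in which [G] dies. *)
Lemma permutation_model (a : nat -> G) (Q : groupType) (rQ : Q) (tQ : nat -> Q) :
  a 0%N = a0 -> rQ ^+ k = 1 -> tQ 0%N = 1 ->
  exists (M : groupType) (j : G -> M) (r : M) (t : nat -> M) (q : M -> Q),
    [/\ {morph j : x y / x * y} /\ injective j,
        forall z, zpow r z = 1 -> z = 0%R,
        [/\ t 0%N = 1, r ^+ k = j (a 0%N) &
            forall n, a n <> 1 -> r ^+ k * t n = t n * j (a n)],
        {morph q : x y / x * y} &
        [/\ forall g, q (j g) = 1, q r = rQ & forall n, q (t n) = tQ n]].
Proof.
move=> aE rQk tQ0.
have /choice[fs fsP] : forall n, exists f :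
    (G * nat -> int * nat) * (int * nat -> G * nat),
    [/\ cancel f.1 f.2, cancel f.2 f.1 & a n <> 1 ->
        forall g m, f.1 (a n * g, m) = (int_shift ^+ k) (f.1 (g, m))].
  (* When [a n = 1], the bijection for [a0] is used as a filler. *)
  move=> n; have [an1|/shift_bijection_root[f [f' [fK f'K fx]]]] :=
      pselect (a n = 1); last by exists (f, f').
  have [f [f' [fK f'K _]]] := shift_bijection_root a0_neq1.
  by exists (f, f').
pose f n := (fs n).1; pose f' n := (fs n).2.
have fK n : cancel (f n) (f' n) by case: (fsP n).
have f'K n : cancel (f' n) (f n) by case: (fsP n).
have fa n : a n <> 1 -> forall u,
    f n (a n * u.1, u.2) = (int_shift ^+ k) (f n u).
  by case: (fsP n) => _ _ fx /fx{}fx [g m]; apply: fx.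
pose lmul g (u : G * nat) := (g * u.1, u.2).
have lmulK g : cancel (lmul g) (lmul g^-1).
  by move=> [x m]; rewrite /lmul /= mulKg.
have lmulKV g : cancel (lmul g^-1) (lmul g).
  by move=> [x m]; rewrite /lmul /= mulVKg.
pose j1 g : permutation (int * nat) := Permutation
  (can_comp (fK 0%N) (can_comp (lmulK g) (f'K 0%N)))
  (can_comp (can_comp (fK 0%N) (lmulKV g)) (f'K 0%N)).
pose t1 n : permutation (int * nat) := Permutation
  (can_comp (fK n) (f'K 0%N)) (can_comp (fK 0%N) (f'K n)).
have j1E g u : j1 g u = f 0%N (lmul g (f' 0%N u)) by [].
have t1E n u : t1 n u = f n (f' 0%N u) by [].
have j1M : {morph j1 : x y / x * y}.
  move=> x y; apply: permutation_eq => u; rewrite permME !j1E fK.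
  by rewrite /lmul /= mulgA.
have rt1 n : a n <> 1 -> int_shift ^+ k * t1 n = t1 n * j1 (a n).
  move=> an_neq1; apply: permutation_eq => u; rewrite !permME !t1E j1E fK.
  by rewrite -fa.
have t10 : t1 0%N = 1 by apply: permutation_eq => u; rewrite t1E f'K.
exists (permutation (int * nat) * Q)%type, (fun g => (j1 g, 1)),
  (int_shift, rQ), (fun n => (t1 n, tQ n)), snd.
have pairX (x : permutation (int * nat) * Q) n : x ^+ n = (x.1 ^+ n, x.2 ^+ n).
  by elim: n => [|n IHn] //; rewrite !expgS IHn.
split=> //.
- split=> [x y|]; first by rewrite j1M -[1 in LHS]mulg1.
  move=> x y /(congr1 fst) jxy; have := congr1
    (fun s : permutation _ => (f' 0%N (s (f 0%N (1, 0%N)))).1) jxy.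
  by rewrite /= !fK /lmul /= !mulg1.
- move=> z rz; apply: int_shift_free.
  have := @morph_zpow (permutation (int * nat) * Q)%type
    (permutation (int * nat)) fst (fun _ _ => erefl) (int_shift, rQ) z.
  by rewrite rz => <-.
- split=> [||n an_neq1]; first by rewrite t10 tQ0.
    by rewrite pairX /= rQk -[X in (X, _)]mulg1 -t10 rt1 ?aE // t10 mul1g.
  by rewrite pairX /= rQk /= -[RHS]/(t1 n * j1 (a n), tQ n * 1) -rt1 // mulg1
    -[tQ n in RHS]mul1g.
Qed.

End Model.

(** * A quotient in which the candidate basis is free *)

Section FreeModel.
Variable k : nat.
Local Notation L := (free_group nat).
Local Notation Y := (L * 'I_k.+2)%type.

(** The inverse rotation takes slot 0 to slot [s1], so conjugation by it brings the action on slot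
    [s1] to slot 0. *)
Definition slot_rot : permutation Y.
Proof.
by exists (fun u => (u.1, ord_pred u.2)) (fun u => (u.1, ordS u.2)) => -[l s] /=;
  rewrite ?ordSK ?ord_predK.
Defined.

Definition slot_mul (e : 'I_k.+2 -> L) : permutation Y.
Proof.
by exists (fun u => (e u.2 * u.1, u.2)) (fun u => ((e u.2)^-1 * u.1, u.2))
  => -[l s] /=; rewrite ?mulKg ?mulVKg.
Defined.

Lemma slot_rotX : slot_rot ^+ k.+2 = 1.
Proof.
suff : slot_rot^-1 ^+ k.+2 = 1.
  by rewrite expVgn => /eqP; rewrite invg_eq1 => /eqP.
apply: permutation_eq => -[l s]; rewrite perm1E.
suff -> : forall n, (slot_rot^-1 ^+ n) (l, s) = (l, inord ((s + n) %% k.+2)%N).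
  by rewrite modnDr modn_small // inord_val.
elim=> [|n IHn]; first by rewrite addn0 modn_small // inord_val.
rewrite expgS permME IHn; congr (_, _); apply: val_inj => /=.
have lt m : (m %% k.+2 < k.+2)%N by rewrite ltn_mod.
rewrite !inordK // -addn1 modnDml; congr (_ %% _)%N; lia.
Qed.

(* [L * {0}] is invariant under the [t n.+1] and their conjugates, which act on
   it as left multiplications by distinct generators. *)
Lemma free_model : exists (Q : groupType) (r : Q) (t : nat -> Q),
  [/\ r ^+ k.+2 = 1, t 0%N = 1 &
      injective (free_lift (fun i : nat =>
        if odd i then t i./2.+1 ^ r^-1 else t i./2.+1))].
Proof.
pose s1 : 'I_k.+2 := ordS ord0.
(* The letter [t n.+1] acts by generator [2n] on slot 0; its conjugate acts there by generator
   [2n + 1]. *)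
pose e n (s : 'I_k.+2) : L :=
  if s == ord0 then free_gen n.*2 else if s == s1 then free_gen n.*2.+1 else 1.
pose t n : permutation Y := if n is n'.+1 then slot_mul (e n') else 1.
exists (permutation Y), slot_rot, t; split=> //; first exact: slot_rotX.
set x := fun i : nat => _; set X := free_lift x.
have XM : {morph X : u v / u * v} := free_liftM x.
have s10 : s1 != ord0 by [].
have x_slot i l : x i (l, ord0) = (free_gen i * l, ord0).
  rewrite /x; have := odd_double_half i; case: (odd i) => iE.
    rewrite conjgE invgK !permME /= -/s1 /e (negbTE s10) eqxx ordSK.
    by congr (free_gen _ * _, _).
  by rewrite /= /e eqxx; congr (free_gen _ * _, _).
have X_slot u l : X u (l, ord0) = (u * l, ord0).
  rewrite -(fwordK u); elim: (fword u) l => [|[i b] w IHw] l.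
    by rewrite -[word_val _]/(1 : L) (morph_1 XM) mul1g.
  rewrite -[word_val _]/(free_letter (i, b) * word_val w) XM permME IHw.
  rewrite free_letterE; case: b.
    by rewrite /X free_lift_gen x_slot mulgA.
  rewrite (morph_V XM) /X free_lift_gen; apply: (can_inj (@permfK _ (x i))).
  by rewrite -permME mulgV perm1E x_slot mulgA mulVKg.
apply: (morph_inj XM) => u Xu1; have := X_slot u 1.
by rewrite Xu1 mulg1 perm1E => -[].
Qed.

End FreeModel.

(** * The embedding when the given generator is nontrivial *)

Lemma embedding_neq1 (k : nat) (G : groupType) (a0 : G) : (2 <= k)%N ->
  countable [set: G] -> torsion_free G -> is_CSA G -> max_abelian_cyclic G ->
  maximal_abelian (generated_by [set a0]) -> a0 <> 1 ->
  exists (H : groupType) (iota : {multiplicative G -> H}),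
    [/\ injective iota,
        axial H,
        exists (F : set H) (r : H),
          [/\ free_subgroup_countable_rank F,
              r ^+ k = iota a0 &
              generated_by (F `|` [set r]) = [set: H]],
        (forall A B : set G, maximal_abelian A -> maximal_abelian B ->
           conjugate_subgroups (iota @` A) (iota @` B)) &
        forall g : G, exists h : H, h ^+ k = iota g].
Proof.
move=> k_ge2 G_countable G_tf G_CSA G_cyc ha0 a0_neq1.
case: k k_ge2 => [|[|k]] // _.
have [a [aE conjA sepA]] := max_abelian_reps G_countable G_CSA G_cyc ha0 a0_neq1.
have [Q [rQ [tQ [rQk tQ0 free_inj]]]] := free_model k.
have [M [j [r [t [q [[jM j_inj] r_free [t0 ra0 rt] qM [qj qr qt]]]]]]] :=
  permutation_model (ltn0Sn k.+1) G_countable G_tf a0_neq1 aE rQk tQ0.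
have coverA g : exists n x z, g = (zpow (a n) z) ^ x.
  have [A maxA Ag] := max_abelian_exists g; have [n [u [_ Au]]] := conjA A maxA.
  have : conj_set A u (g ^ u) by exists g.
  by rewrite Au => /generated_by1P[z gz]; exists n, u^-1, z; rewrite -gz conjgK.
have [H [iota [root [tau [p [axH [iotaM pM] [pi pr pt]
  [rootX tau0 root_tau] gens]]]]]] := core_construction jM j_inj r_free t0 ra0 rt coverA sepA.
have iota_inj : injective iota.
  by move=> x y /(congr1 p); rewrite !pi => /j_inj.
exists H, (mult_pack iotaM); split=> //=.
- have [c c_inj] := countable_injP _ G_countable.
  (* [g_] inverts the injection [c], with value [1] off its range: it enumerates [G]. *)
  have /choice[g_ g_surj] : forall n, exists g, (exists g', c g' = n) -> c g = n.
    move=> n; have [[g gn]|ng] := pselect (exists g, c g = n); first by exists g.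
    by exists 1.
  have g_c g : g_ (c g) = g.
    by apply: c_inj; rewrite ?in_setE //; apply: g_surj; exists g.
  pose x i : H := if odd i then (tau i./2.+1 * iota (g_ i./2)) ^ root^-1
                  else tau i./2.+1.
  pose phi : free_group nat -> H := free_lift x.
  have phiM : {morph phi : u v / u * v} := free_liftM x.
  have phi_inj : injective phi.
    (* In [Q] the factors from [G] vanish and the generators map to the free family of
       [free_model]. *)
    pose psi := q \o p \o phi.
    have psiM : {morph psi : u v / u * v}.
      by move=> u v; rewrite /psi /= phiM pM qM.
    suff psiE : psi =1 free_lift (fun i : nat =>
        if odd i then tQ i./2.+1 ^ rQ^-1 else tQ i./2.+1).
      by move=> u v uv; apply: free_inj; rewrite -!psiE /psi /= uv.
    apply: free_lift_unique => // i.
    rewrite /psi /= /phi free_lift_gen /x; case: ifP => _; last by rewrite pt qt.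
    rewrite (morph_J pM) (morph_J qM) pM qM (morph_V pM) (morph_V qM).
    by rewrite pi pr pt qj qr qt mulg1.
  exists (range phi), root; split.
  + exists (free_group nat), (@free_gen nat), (mult_pack phiM).
    by split=> //; apply: free_group_basis.
  + by rewrite rootX aE.
  (* Even generators give the [tau n]; then the odd generator of index [(c g).*2.+1], conjugated by
     [root], gives [iota g]. *)
  set S := generated_by _; have sS : is_subgroup S := generated_by_subgroup _.
  have [S1 SM SV] := sS.
  have Sphi u : S (phi u) by apply: sub_gen_smallest; left; exists u.
  have Sr : S root by apply: sub_gen_smallest; right.
  have xE i : phi (free_gen i) = x i := free_lift_gen x i.
  have St n : S (tau n).
    case: n => [|n]; first by rewrite tau0.
    by have := Sphi (free_gen n.*2); rewrite xE /x odd_double doubleK.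
  apply: gens => // g.
  have := Sphi (free_gen (c g).*2.+1).
  rewrite xE /x /= odd_double /= uphalf_double g_c.
  move=> Sx; rewrite -(mulKg (tau (c g).+1) (iota g)); apply: (SM); first exact: SV.
  rewrite -(conjgKV root (_ * _)) conjgE; apply: (SM); first exact: SV.
  exact: SM.
(* All maximal abelian subgroups are compared with [<root ^+ k.+2>], to which [tau n] conjugates
   each [<iota (a n)>] with [a n <> 1]. *)
- have conj_root A : maximal_abelian A -> exists u,
      conj_set (iota @` A) u = generated_by [set root ^+ k.+2].
    move=> /conjA[n [u [an_neq1 Au]]]; exists (iota u * (tau n)^-1).
    have rootE : root ^+ k.+2 = iota (a n) ^ (tau n)^-1.
      by rewrite conjgE invgK mulgA -root_tau // mulgK.
    rewrite rootE -conj_setM.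
    have -> : conj_set (iota @` A) (iota u) = iota @` generated_by [set a n].
      rewrite -Au; apply/seteqP; split=> [_ [_ [x Ax <-] <-]|_ [_ [x Ax <-] <-]].
        by exists (x ^ u); [exists x|rewrite (morph_J iotaM)].
      by exists (iota x); [exists x|rewrite (morph_J iotaM)].
    apply/seteqP; split=> [_ [_ [x /generated_by1P[z ->] <-] <-]|x].
      by apply/generated_by1P; exists z; rewrite (morph_zpow iotaM) zpowJ.
    move=> /generated_by1P[z ->]; exists (iota (zpow (a n) z)).
      by exists (zpow (a n) z) => //; apply/generated_by1P; exists z.
    by rewrite (morph_zpow iotaM) zpowJ.
  move=> A B /conj_root[u uA] /conj_root[v vB]; exists (u * v^-1).
  by rewrite -conj_setM uA -vB conj_setM mulgV conj_set1.
- move=> g; have [n [u [z ->]]] := coverA g.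
  have [an1|an_neq1] := pselect (a n = 1).
    by exists 1; rewrite an1 zpow1n conj1g (morph_1 iotaM) expg1n.
  (* If [g] is the conjugate by [u] of a power [z] of [a n], the root is the same power of [root],
     conjugated by [tau n] and then by [iota u]. *)
  exists (zpow root z ^ (tau n * iota u)).
  rewrite -conjXg -zpow_nat zpowM GRing.mulrC -zpowM zpow_nat.
  have -> : root ^+ k.+2 = iota (a n) ^ (tau n)^-1.
    by rewrite conjgE invgK mulgA -root_tau // mulgK.
  by rewrite (morph_J iotaM) (morph_zpow iotaM) conjgM !zpowJ conjgKV.
Qed.

(** * The integers in multiplicative notation, and the case of a trivial group *)

Record int_group := IntGroup { int_of_group : int }.

HB.instance Definition _ := [isNew for int_of_group].
HB.instance Definition _ := [Countable of int_group by <:].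

Section IntGroup.
Implicit Types x y z : int_group.
Local Open Scope ring_scope.

Definition int_group_mul x y := IntGroup (int_of_group x + int_of_group y).
Definition int_group_inv x := IntGroup (- int_of_group x).

Fact int_group_mulA : associative int_group_mul.
Proof. by move=> x y z; congr IntGroup; apply: GRing.addrA. Qed.
Fact int_group_mul1g : left_id (IntGroup 0) int_group_mul.
Proof. by move=> [x]; congr IntGroup; apply: GRing.add0r. Qed.
Fact int_group_mulg1 : right_id (IntGroup 0) int_group_mul.
Proof. by move=> [x]; congr IntGroup; apply: GRing.addr0. Qed.
Fact int_group_mulVg : left_inverse (IntGroup 0) int_group_inv int_group_mul.
Proof. by move=> x; congr IntGroup; apply: GRing.addNr. Qed.
Fact int_group_mulgV : right_inverse (IntGroup 0) int_group_inv int_group_mul.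
Proof. by move=> x; congr IntGroup; apply: GRing.subrr. Qed.

End IntGroup.

HB.instance Definition _ := isGroup.Build int_group int_group_mulA
  int_group_mul1g int_group_mulg1 int_group_mulVg int_group_mulgV.

Lemma int_group_axial : axial int_group.
Proof. by move=> h _; exists setT, int_of_group; split=> // -[x] _ /= ->. Qed.

Lemma int_group_zpow (x : int_group) : x = zpow (IntGroup 1) (int_of_group x).
Proof.
apply: val_inj.
by rewrite /= (@embed_zpow _ setT int_of_group) //= GRing.mul1r.
Qed.

(** The construction is applied to the integers with [k = 2]: the free group is a subgroup of the
    resulting axial group and inherits axiality. *)
Lemma free_group_axial : exists (L : groupType) (x : nat -> L),
  free_with_basis x /\ axial L.
Proof.
have axZ := int_group_axial.
have countZ : countable [set: int_group] by exact: countableP.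
have Z1 x : generated_by [set IntGroup 1] x.
  by apply/generated_by1P; exists (int_of_group x); apply: int_group_zpow.
have maxZ : maximal_abelian (generated_by [set IntGroup 1]).
  split; [exact: generated_by_subgroup|exact: generated_by_zpow_abelian|].
  by move=> B _ _ ZB; apply/seteqP; split.
have [|H [_ [_ axH [F [_ [[L [x [j [Lx j_inj _]]]] _ _]]] _ _]]] :=
  embedding_neq1 (leqnn 2) countZ (axial_torsion_free axZ)
    (axial_CSA axZ) (axial_max_abelian_cyclic axZ) maxZ.
  by [].
exists L, x; split=> //; apply: (axial_inj (f := j)) axH => //; exact: gmulfM.
Qed.

Theorem lemma3 (k : nat) (hk : (2 <= k)%N)
  (G : groupType)
  (G_countable : countable [set: G])
  (G_torsion_free : torsion_free G)
  (G_CSA : is_CSA G)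
  (G_max_abelian_cyclic : max_abelian_cyclic G)
  (a0 : G) (ha0 : maximal_abelian (generated_by [set a0])) :
  exists (H : groupType) (iota : {multiplicative G -> H}),
    [/\ injective iota,
        [/\ torsion_free H, is_CSA H & max_abelian_cyclic H],
        exists (F : set H) (r : H),
          [/\ free_subgroup_countable_rank F,
              r ^+ k = iota a0 &
              generated_by (F `|` [set r]) = [set: H]],
        (forall A B : set G, maximal_abelian A -> maximal_abelian B ->
           conjugate_subgroups (iota @` A) (iota @` B)) &
        forall g : G, exists h : H, h ^+ k = iota g].
Proof.
have [a0_eq1|a0_neq1] := pselect (a0 = 1); last first.
  have [H [iota [iota_inj axH FH conjH rootH]]] := embedding_neq1 hk G_countable
    G_torsion_free G_CSA G_max_abelian_cyclic ha0 a0_neq1.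
  exists H, iota; split=> //; split.
  - exact: axial_torsion_free.
  - exact: axial_CSA.
  - exact: axial_max_abelian_cyclic.
(* The trivial subgroup is maximal abelian here, so every cyclic subgroup of [G] is trivial. *)
have G1 (g : G) : g = 1.
  have [_ _ /(_ (generated_by [set g]))] := ha0.
  have trivE z : generated_by [set a0] z -> z = 1.
    by move=> /generated_by1P[w ->]; rewrite a0_eq1 zpow1n.
  move=> gE; apply: (trivE); rewrite -gE; first by apply/generated_by1P; exists 1%R.
  - exact: generated_by_subgroup.
  - exact: generated_by_zpow_abelian.
  - by move=> z /trivE ->; have [] := generated_by_subgroup [set g].
have [L [x [Lx axL]]] := free_group_axial.
have iotaM : {morph (fun _ : G => 1 : L) : u v / u * v}.
  by move=> u v; rewrite mulg1.
(* [H] is the free group itself, with [F = H] and [r = 1]. *)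
exists L, (mult_pack iotaM); split=> /=.
- by move=> u v _; rewrite (G1 u) (G1 v).
- split; [exact: axial_torsion_free|exact: axial_CSA|].
  exact: axial_max_abelian_cyclic.
- exists setT, 1; split.
  + exists L, x, idfun; split=> //.
    by apply/seteqP; split=> // u _; exists u.
  + by rewrite expg1n.
  + by apply/seteqP; split=> // u _; apply: sub_gen_smallest; left.
- move=> A B [[A1 _ _] _ _] [[B1 _ _] _ _]; exists 1; rewrite conj_set1.
  by apply/seteqP; split=> _ [u _ <-]; exists 1.
- by move=> g; exists 1; rewrite expg1n.
Qed.
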